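(* Let $\Lambda$ be an Auslander algebra and $M$ a finitely generated right $\Lambda$-module. Then the following hold. (1) Every simple $\Lambda$-module $S$ is $\tau$-rigid. (2) If $\mathrm{pd}_{\Lambda}M=1$, then $M$ is rigid (equivalently, since $\mathrm{pd}_\Lambda M=1$, $\tau$-rigid) if and only if $\mathrm{Ext}_{\Lambda}^2(N,M)=0$, where $N=M^{**}/M$. (3) If $\mathrm{grade}\,M=2$, then $M$ is $\tau$-rigid if and only if $\mathrm{Tr}M$ is $\tau$-rigid (as a $\Lambda^{op}$-module) with projective dimension $\mathrm{pd}\,\mathrm{Tr}M=1$. (4) If $\Lambda$ admits a unique (up to isomorphism) simple module $S$ with $\mathrm{pd}_{\Lambda}S=2$, then (a) every indecomposable $\Lambda$-module $M$ with $\mathrm{pd}_{\Lambda}M=1$ is rigid (equivalently, $\tau$-rigid); (b) every indecomposable $\tau$-rigid $\Lambda$-module $N$ with $\mathrm{pd}_{\Lambda}N=2$ satisfies $\mathrm{grade}\,N=2$.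
   Context: All algebras are basic connected finite-dimensional algebras over an algebraically closed field $K$, and all modules are finitely generated right modules. $\Lambda^{op}$ is the opposite algebra. An algebra $\Lambda$ is an Auslander algebra if $\mathrm{gl.dim}\,\Lambda\le 2$ and $I_i(\Lambda)$ is projective for $i=0,1$, where $I_i(\Lambda)$ is the $(i+1)$-th term in a minimal injective resolution $0\to\Lambda\to I_0(\Lambda)\to I_1(\Lambda)\to\cdots$; equivalently, $\Lambda=\mathrm{End}_R(A)$ for a representation-finite algebra $R$ and an additive generator $A$ of the category of finitely generated $R$-modules. $\mathrm{pd}$ denotes projective dimension. $(-)^*=\mathrm{Hom}_\Lambda(-,\Lambda)$ (and likewise over $\Lambda^{op}$); $M^{**}/M$ denotes the cokernel of the canonical evaluation map $M\to M^{**}$ (which is injective for $\mathrm{pd}_\Lambda M\le 1$). $\mathrm{Tr}$ is the Auslander transpose (the cokernel of $P_0^*\to P_1^*$ for a minimal projective presentation $P_1\to P_0\to M\to 0$), and $\tau$ is the Auslander–Reiten translation. For an integer $i\ge1$, $\mathrm{grade}\,M\ge i$ means $\mathrm{Ext}^j_\Lambda(M,\Lambda)=0$ for $0\le j\le i-1$; $\mathrm{grade}\,M=2$ means $\mathrm{grade}\,M\ge 2$ and $\mathrm{Ext}^2_\Lambda(M,\Lambda)\ne0$. $M$ is rigid if $\mathrm{Ext}^1_\Lambda(M,M)=0$, and $\tau$-rigid if $\mathrm{Hom}_\Lambda(M,\tau M)=0$. A module of projective dimension $1$ is rigid if and only if it is $\tau$-rigid. *)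

(* Defs.v *)
From HB Require Import structures.
From mathcomp Require Import all_boot all_order all_algebra all_field.

Set Implicit Arguments.
Unset Strict Implicit.
Unset Printing Implicit Defensive.

Import GRing.Theory.
Local Open Scope ring_scope.

(* MathComp provides the ring structure of the converse [A^c]; here it gets
   the finite-dimensional algebra structure over the same field. *)
Section OppositeAlgebra.
Variables (K : fieldType) (A : falgType K).

HB.instance Definition _ := GRing.Lmodule.copy A^c A.
HB.instance Definition _ := SemiVector.copy A^c A.

Fact converse_scalerAl (k : K) (x y : A^c) : k *: (x * y) = (k *: x : A^c) * y.
Proof. exact: (@scalerAr K A k y x). Qed.
HB.instance Definition _ :=
  GRing.Lmodule_isLalgebra.Build K A^c converse_scalerAl.

Fact converse_scalerAr (k : K) (x y : A^c) : k *: (x * y) = x * (k *: y : A^c).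
Proof. exact: (@scalerAl K A k y x). Qed.
HB.instance Definition _ :=
  GRing.Lalgebra_isAlgebra.Build K A^c converse_scalerAr.

Definition opalg : falgType K := A^c.

End OppositeAlgebra.

(* Finitely generated right [A]-modules: over a finite-dimensional algebra these
   are exactly the right modules of finite dimension over [K]. *)
Record rmod (K : fieldType) (A : falgType K) := RMod {
  rmod_sort :> vectType K;
  ract : rmod_sort -> A -> rmod_sort;
  ract_linl : forall a, linear (fun x => ract x a);
  ract_linr : forall x, linear (ract x);
  ract1 : forall x, ract x 1 = x;
  ractM : forall x a b, ract x (a * b) = ract (ract x a) b
}.

Lemma ractPl (K : fieldType) (A : falgType K) (M : rmod A) k (x y : M) a :
  ract (k *: x + y) a = k *: ract x a + ract y a.
Proof. exact: (ract_linl a k x y). Qed.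

Lemma ractPr (K : fieldType) (A : falgType K) (M : rmod A) k (x : M) (a b : A) :
  ract x (k *: a + b) = k *: ract x a + ract x b.
Proof. exact: (ract_linr x k a b). Qed.

Section Homs.
Variable K : fieldType.

Definition lin_fun (U V : vectType K) (f : U -> V) of linear f := f.
HB.instance Definition _ (U V : vectType K) (f : U -> V) (lf : linear f) :=
  GRing.isLinear.Build K U V _ (lin_fun lf) lf.

Fact mklfun_key : unit. Proof. by []. Qed.
Definition mklfun (U V : vectType K) (f : U -> V) (lf : linear f) : 'Hom(U, V) :=
  locked_with mklfun_key (linfun (lin_fun lf)).

Lemma mklfunE (U V : vectType K) (f : U -> V) (lf : linear f) x :
  mklfun lf x = f x.
Proof. by rewrite /mklfun locked_withE lfunE. Qed.

Section Defect.
Variables (A : falgType K) (M N : rmod A).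

Fact hom_defect_lin1 (f : 'Hom(M, N)) (a : A) :
  linear (fun x => f (ract x a) - ract (f x) a).
Proof.
move=> k x y; by rewrite ractPl !linearP ractPl scalerBr opprD addrACA.
Qed.

Fact hom_defect_lin2 (f : 'Hom(M, N)) :
  linear (fun a => mklfun (hom_defect_lin1 f a)).
Proof.
move=> k a b; apply/lfunP=> x; rewrite add_lfunE scale_lfunE !mklfunE.
by rewrite !ractPr linearP scalerBr opprD addrACA.
Qed.

Fact hom_defect_lin3 : linear (fun f => mklfun (hom_defect_lin2 f)).
Proof.
move=> k f g; apply/lfunP=> a; apply/lfunP=> x.
rewrite !(add_lfunE, scale_lfunE, mklfunE).
by rewrite ractPl scalerBr opprD addrACA.
Qed.

(* [Hom_A(M, N)], as a subspace of the [K]-linear maps: the kernel of the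
   [K]-linear map sending [f] to [a |-> x |-> f (x a) - (f x) a]. *)
Definition homs : {vspace 'Hom(M, N)} := lker (mklfun hom_defect_lin3).

Lemma homsP (f : 'Hom(M, N)) :
  reflect (forall x a, f (ract x a) = ract (f x) a) (f \in homs).
Proof.
rewrite memv_ker mklfunE; apply: (iffP eqP) => [f0 x a | fA].
  move/lfunP/(_ a)/lfunP/(_ x): f0; rewrite !mklfunE !zero_lfunE.
  by move/eqP; rewrite subr_eq0 => /eqP.
apply/lfunP=> a; apply/lfunP=> x; rewrite !mklfunE !zero_lfunE.
by rewrite fA subrr.
Qed.

Definition rhom : Type := subvs_of homs.
Definition hom_lfun (f : rhom) : 'Hom(M, N) := vsval f.

Lemma hom_lfunP k (f g : subvs_of homs) x :
  hom_lfun (k *: f + g) x = k *: hom_lfun f x + hom_lfun g x.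
Proof. by rewrite -scale_lfunE -add_lfunE. Qed.

Lemma homE (f : rhom) x a : hom_lfun f (ract x a) = ract (hom_lfun f x) a.
Proof. by move: x a; apply/homsP; apply: subvsP. Qed.

Definition mkhom (f : 'Hom(M, N)) (hf : forall x a, f (ract x a) = ract (f x) a) :
  rhom := Subvs (introT (homsP f) hf).

End Defect.

Coercion hom_lfun : rhom >-> hom.

Section Basics.
Variable A : falgType K.
Implicit Types M N P Q X Y : rmod A.

Definition injective_hom M N (f : rhom M N) := lker f = 0%VS.
Definition surjective_hom M N (f : rhom M N) := limg f = fullv.
Definition exact_at M N X (f : rhom M N) (g : rhom N X) := limg f = lker g.
Definition iso M N := exists f : rhom M N, injective_hom f /\ surjective_hom f.
Definition zero_mod M := fullv = 0%VS :> {vspace M}.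

(* [q] exhibits its target as the cokernel of [f]. *)
Definition is_cokernel M N X (f : rhom M N) (q : rhom N X) :=
  exact_at f q /\ surjective_hom q.

Definition submodule M (U : {vspace M}) :=
  forall x a, x \in U -> ract x a \in U.
Definition essential M (U : {vspace M}) :=
  forall W : {vspace M}, submodule W -> (W :&: U = 0)%VS -> W = 0%VS.
Definition superfluous M (U : {vspace M}) :=
  forall W : {vspace M}, submodule W -> (W + U = fullv)%VS -> W = fullv.

Definition simple_mod M :=
  ~ zero_mod M /\
  forall U : {vspace M}, submodule U -> U = 0%VS \/ U = fullv.
Definition indecomposable M :=
  ~ zero_mod M /\
  forall U V : {vspace M}, submodule U -> submodule V ->
    (U + V = fullv)%VS -> (U :&: V = 0)%VS -> U = 0%VS \/ V = 0%VS.

Definition projective P :=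
  forall X Y (g : rhom X Y) (h : rhom P Y), surjective_hom g ->
    exists k : rhom P X, forall x, h x = g (k x).
Definition injective_mod Q :=
  forall X Y (g : rhom X Y) (h : rhom X Q), injective_hom g ->
    exists k : rhom Y Q, forall x, h x = k (g x).

Record proj_res M := ProjRes {
  pr_mod : nat -> rmod A;
  pr_d : forall i, rhom (pr_mod i.+1) (pr_mod i);
  pr_eps : rhom (pr_mod 0) M;
  pr_proj : forall i, projective (pr_mod i);
  pr_surj : surjective_hom pr_eps;
  pr_exact0 : exact_at (pr_d 0) pr_eps;
  pr_exactS : forall i, exact_at (pr_d i.+1) (pr_d i)
}.

Record inj_res M := InjRes {
  ir_mod : nat -> rmod A;
  ir_d : forall i, rhom (ir_mod i) (ir_mod i.+1);
  ir_eta : rhom M (ir_mod 0);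
  ir_injm : forall i, injective_mod (ir_mod i);
  ir_inj : injective_hom ir_eta;
  ir_exact0 : exact_at ir_eta (ir_d 0);
  ir_exactS : forall i, exact_at (ir_d i) (ir_d i.+1)
}.

Definition minimal_inj_res M (I : inj_res M) :=
  essential (limg (ir_eta I)) /\ forall i, essential (limg (ir_d I i)).

Definition pd_le n M :=
  exists R : proj_res M, forall i, (n < i)%N -> zero_mod (pr_mod R i).
Definition pd_eq n M := pd_le n M /\ forall m, pd_le m M -> (n <= m)%N.

(* Vanishing of the [i]-th cohomology of the complex [Hom_A(R, N)]. *)
Definition Hom_acyclic_at i M N (R : proj_res M) :=
  match i with
  | 0 => forall f : rhom (pr_mod R 0) N,
      (forall x, f (pr_d R 0 x) = 0) -> forall x, f x = 0
  | j.+1 => forall f : rhom (pr_mod R j.+1) N,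
      (forall x, f (pr_d R j.+1 x) = 0) ->
      exists g : rhom (pr_mod R j) N, forall x, f x = g (pr_d R j x)
  end.

(* [Ext^i_A(M, N) = 0]; the choice of the resolution is immaterial. *)
Definition Ext_zero i M N := exists R : proj_res M, Hom_acyclic_at i N R.

Definition rigid M := Ext_zero 1 M M.

Fact reg_linl a : linear (fun x : A => x * a).
Proof. by move=> k x y; rewrite mulrDl scalerAl. Qed.
Fact reg_linr x : linear (fun a : A => x * a).
Proof. by move=> k a b; rewrite mulrDr scalerAr. Qed.
Definition reg : rmod A :=
  RMod reg_linl reg_linr (@mulr1 A) (@mulrA A).

Definition grade_ge i M := forall j, (j < i)%N -> Ext_zero j M reg.
Definition grade_eq i M := grade_ge i M /\ ~ Ext_zero i M reg.

End Basics.

Section Duality.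
Variable A : falgType K.
Implicit Types M N : rmod A.

(* [M^* = Hom_A(M, A)] with [(a f)(x) = a * f x], as a right [A^op]-module. *)
Section Star.
Variable M : rmod A.

Fact star_act_lin (f : rhom M (reg A)) (a : A) :
  linear (fun x : M => a * (hom_lfun f x : A) : reg A).
Proof. by move=> k x y; rewrite linearP mulrDr scalerAr. Qed.

Fact star_act_hom (f : rhom M (reg A)) (a : A) x b :
  mklfun (star_act_lin f a) (ract x b) = ract (mklfun (star_act_lin f a) x) b.
Proof. by rewrite !mklfunE homE /= mulrA. Qed.

Definition star_act (f : subvs_of (homs M (reg A))) (a : opalg A) :
  subvs_of (homs M (reg A)) := mkhom (star_act_hom f a).

Fact star_linl a : linear (fun f => star_act f a).
Proof.
move=> k f g; apply/subvs_inj/lfunP=> x.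
rewrite linearP add_lfunE scale_lfunE !mklfunE.
by rewrite hom_lfunP mulrDr scalerAr.
Qed.

Fact star_linr f : linear (star_act f).
Proof.
move=> k a b; apply/subvs_inj/lfunP=> x.
by rewrite linearP add_lfunE scale_lfunE !mklfunE mulrDl scalerAl.
Qed.

Fact star_act1 f : star_act f 1 = f.
Proof. by apply/subvs_inj/lfunP=> x; rewrite mklfunE mul1r. Qed.

Fact star_actM f a b : star_act f (a * b) = star_act (star_act f a) b.
Proof. by apply/subvs_inj/lfunP=> x; rewrite !mklfunE mulrA. Qed.

Definition star : rmod (opalg A) := RMod star_linl star_linr star_act1 star_actM.
End Star.

Section StarMap.
Variables (M N : rmod A) (d : rhom M N).

Fact star_map_val_lin (f : star N) : linear (fun x : M => vsval f (d x)).
Proof. by move=> k x y; rewrite !linearP. Qed.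

Fact star_map_val_hom (f : star N) x a :
  mklfun (star_map_val_lin f) (ract x a)
    = ract (mklfun (star_map_val_lin f) x : reg A) a.
Proof. by rewrite !mklfunE homE (homE (f : rhom N (reg A))). Qed.

Definition star_map_val (f : star N) : star M := mkhom (star_map_val_hom f).

Fact star_map_lin : linear star_map_val.
Proof.
move=> k f g; apply/subvs_inj/lfunP=> x.
by rewrite linearP add_lfunE scale_lfunE !mklfunE linearP add_lfunE scale_lfunE.
Qed.

Fact star_map_hom f a :
  mklfun star_map_lin (ract f a) = ract (mklfun star_map_lin f) a.
Proof. by rewrite !mklfunE; apply/subvs_inj/lfunP=> x; rewrite !mklfunE. Qed.

(* [d^* : N^* -> M^*], precomposition with [d]. *)
Definition star_map : rhom (star N) (star M) := mkhom star_map_hom.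
End StarMap.

(* [D M = Hom_K(M, K)] with [(a f)(x) = f (x a)], as a right [A^op]-module. *)
Section Kdual.
Variable M : rmod A.

Fact kdual_act_lin (f : 'Hom(M, K^o)) (a : A) :
  linear (fun x : M => f (ract x a)).
Proof. by move=> k x y; rewrite ractPl linearP. Qed.

Definition kdual_act (f : 'Hom(M, K^o)) (a : opalg A) : 'Hom(M, K^o) :=
  mklfun (kdual_act_lin f a).

Fact kdual_linl a : linear (fun f => kdual_act f a).
Proof.
move=> k f g; apply/lfunP=> x.
by rewrite add_lfunE scale_lfunE !mklfunE add_lfunE scale_lfunE.
Qed.

Fact kdual_linr f : linear (kdual_act f).
Proof.
move=> k a b; apply/lfunP=> x.
by rewrite add_lfunE scale_lfunE !mklfunE ractPr linearP.
Qed.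

Fact kdual_act1 f : kdual_act f 1 = f.
Proof. by apply/lfunP=> x; rewrite mklfunE ract1. Qed.

Fact kdual_actM f a b : kdual_act f (a * b) = kdual_act (kdual_act f a) b.
Proof. by apply/lfunP=> x; rewrite !mklfunE ractM. Qed.

Definition kdual : rmod (opalg A) :=
  RMod kdual_linl kdual_linr kdual_act1 kdual_actM.
End Kdual.

End Duality.

Section Translate.
Variable A : falgType K.
Implicit Types M N : rmod A.

(* [A^op^op] has the carrier and the operations of [A], but is not the same
   structure for Rocq, whence this change of base algebra. *)
Section Unop.
Variable M : rmod (opalg (opalg A)).
Definition unop_act (x : M) (a : A) : M := @ract K (opalg (opalg A)) M x a.
Fact unop_linl a : linear (fun x => unop_act x a).
Proof. exact: ract_linl. Qed.
Fact unop_linr x : linear (unop_act x).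
Proof. exact: (@ract_linr K (opalg (opalg A)) M x). Qed.
Fact unop_act1 x : unop_act x 1 = x.
Proof. exact: (@ract1 K (opalg (opalg A)) M x). Qed.
Fact unop_actM x a b : unop_act x (a * b) = unop_act (unop_act x a) b.
Proof. exact: (@ractM K (opalg (opalg A)) M x a b). Qed.
Definition unop : rmod A := RMod unop_linl unop_linr unop_act1 unop_actM.
End Unop.

Definition bidual M : rmod A := unop (star (star M)).

Section Evaluation.
Variable M : rmod A.

Fact ev_val_lin (x : M) : linear (fun f : star M => vsval f x : reg (opalg A)).
Proof. by move=> k f g; rewrite linearP add_lfunE scale_lfunE. Qed.

Fact ev_val_hom (x : M) (f : star M) (a : opalg A) :
  mklfun (ev_val_lin x) (ract f a) = ract (mklfun (ev_val_lin x) f) a.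
Proof. by rewrite !mklfunE. Qed.

Definition ev_val (x : M) : bidual M := mkhom (ev_val_hom x).

Fact ev_lin : linear ev_val.
Proof.
move=> k x y; apply/subvs_inj/lfunP=> f.
by rewrite linearP add_lfunE scale_lfunE !mklfunE linearP.
Qed.

Fact ev_hom x a : mklfun ev_lin (ract x a) = ract (mklfun ev_lin x) a.
Proof.
rewrite !mklfunE; apply/subvs_inj/lfunP=> f.
by rewrite !mklfunE (homE (f : rhom M (reg A))).
Qed.

Definition ev : rhom M (bidual M) := mkhom ev_hom.
End Evaluation.

(* Up to isomorphism, [T] is the transpose of [M]: the cokernel of
   [d^* : P0^* -> P1^*] for a minimal projective presentation
   [P1 -d-> P0 -e-> M -> 0]. *)
Definition is_transpose M (T : rmod (opalg A)) :=
  exists (P1 P0 : rmod A) (d : rhom P1 P0) (e : rhom P0 M)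
         (q : rhom (star P1) T),
    [/\ projective P1, projective P0, is_cokernel d e,
        superfluous (lker e) /\ superfluous (lker d)
      & is_cokernel (star_map d) q].

(* [X] is isomorphic to the Auslander-Reiten translate [D Tr M]. *)
Definition is_tau M (X : rmod A) :=
  exists T : rmod (opalg A), is_transpose M T /\ iso X (unop (kdual T)).

Definition tau_rigid M :=
  exists X : rmod A, is_tau M X /\ homs M X = 0%VS.

End Translate.

Section Algebras.
Variable A : falgType K.

(* The regular module is a direct sum of pairwise non-isomorphic
   indecomposable modules. *)
Definition basic_alg :=
  exists (n : nat) (P : 'I_n -> rmod A) (j : forall i, rhom (P i) (reg A)),
    [/\ forall i, indecomposable (P i) /\ injective_hom (j i),
        directv (\sum_i limg (j i))%VS,
        (\sum_i limg (j i))%VS = fullv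
      & forall i k, iso (P i) (P k) -> i = k].

Definition connected_alg :=
  forall e : A, e * e = e -> (forall a, e * a = a * e) -> e = 0 \/ e = 1.

Definition auslander_alg :=
  (forall M : rmod A, pd_le 2 M) /\
  exists I : inj_res (reg A),
    [/\ minimal_inj_res I, projective (ir_mod I 0) & projective (ir_mod I 1)].

End Algebras.
End Homs.

(* Main.v *)
Require Import Defs.
From HB Require Import structures.
From mathcomp Require Import all_boot all_order all_algebra all_field.
From Stdlib Require Import Classical.

(** Over an algebra of global dimension at most 2 the kernel of a map between
    projective modules is projective; in particular every bidual is projective.
    If moreover [A] embeds in a projective-injective [I0] with cokernel in a
    projective-injective [I1], then torsion modules ([X^* = 0]) are closed under
    submodules and satisfy [Ext^1(X, A) = 0], so that modules of projective dimension
    at most 1 are torsionless, and the simple torsion modules are exactly those of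
    projective dimension 2.

    For a minimal presentation [P1 -> P0 -> M -> 0], both [Hom(M, D Tr M) = 0] and the
    surjectivity of [Hom(P0, M) -> Hom(P1, M)] express that [M (x) Tr M = 0]; this turns
    tau-rigidity into a lifting property and makes it symmetric in [M] and [Tr M],
    which is (3). (2) is the dimension shift along [0 -> M -> M^** -> N -> 0].

    For (4), an indecomposable [L] with [pd L = 1] sits in a projective [G] with [G / L]
    torsion, hence an iterated extension of copies of [S]; since [S] has no
    self-extension, [L] is the first syzygy of [S], and its rigidity comes from the left
    almost split property of the last map in the minimal resolution of [S]. If [N] is
    tau-rigid with torsion part [T] and [N / T] is not projective, then [N / T] lies in a
    projective [G] with nonzero torsion quotient [C], and a nonzero map
    [T -> S -> C] contradicts tau-rigidity; so [N / T] is projective, the extension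
    splits, and [N = T]. *)

Set Implicit Arguments.
Unset Strict Implicit.
Unset Printing Implicit Defensive.

Import GRing.Theory.
Local Open Scope ring_scope.

Arguments pr_proj {K A M} p i.

(** * Modules and homomorphisms *)

Section Modules.
Variables (K : fieldType) (A : falgType K).
Implicit Types M N P Q X Y Z : rmod A.

Lemma ractDl M (x y : M) a : ract (x + y) a = ract x a + ract y a.
Proof. by have := ractPl 1 x y a; rewrite !scale1r. Qed.
Lemma ract0l M a : ract (0 : M) a = 0.
Proof. by apply: (addrI (ract (0 : M) a)); rewrite -ractDl !addr0. Qed.
Lemma ractZl M k (x : M) a : ract (k *: x) a = k *: ract x a.
Proof. by have := ractPl k x 0 a; rewrite ract0l !addr0. Qed.
Lemma ractNl M (x : M) a : ract (- x) a = - ract x a.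
Proof. by rewrite -scaleN1r ractZl scaleN1r. Qed.
Lemma ractBl M (x y : M) a : ract (x - y) a = ract x a - ract y a.
Proof. by rewrite ractDl ractNl. Qed.
Lemma ract_suml M I (r : seq I) (p : pred I) (F : I -> M) a :
  ract (\sum_(i <- r | p i) F i) a = \sum_(i <- r | p i) ract (F i) a.
Proof.
by apply: (big_morph (fun x : M => ract x a)) => [x y|]; rewrite ?ractDl ?ract0l.
Qed.

Lemma ractDr M (x : M) a b : ract x (a + b) = ract x a + ract x b.
Proof. by have := ractPr 1 x a b; rewrite !scale1r. Qed.
Lemma ract0r M (x : M) : ract x 0 = 0.
Proof. by apply: (addrI (ract x 0)); rewrite -ractDr !addr0. Qed.
Lemma ractZr M k (x : M) a : ract x (k *: a) = k *: ract x a.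
Proof. by have := ractPr k x a 0; rewrite ract0r !addr0. Qed.
Lemma ractNr M (x : M) a : ract x (- a) = - ract x a.
Proof. by rewrite -scaleN1r ractZr scaleN1r. Qed.
Lemma hom0 M N (f : rhom M N) : f 0 = 0. Proof. exact: linear0. Qed.
Lemma homD M N (f : rhom M N) x y : f (x + y) = f x + f y.
Proof. exact: linearD. Qed.
Lemma homB M N (f : rhom M N) x y : f (x - y) = f x - f y.
Proof. exact: linearB. Qed.
Lemma hom_sum M N (f : rhom M N) I (r : seq I) (p : pred I) (F : I -> M) :
  f (\sum_(i <- r | p i) F i) = \sum_(i <- r | p i) f (F i).
Proof. exact: linear_sum. Qed.

Lemma hom_ex M N (f : M -> N) : linear f ->
  (forall x a, f (ract x a) = ract (f x) a) ->
  exists g : rhom M N, forall x, g x = f x.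
Proof.
move=> lf ef; have h x a : mklfun lf (ract x a) = ract (mklfun lf x) a.
  by rewrite !mklfunE.
by exists (mkhom h) => x; rewrite mklfunE.
Qed.

Fact comp_hom_subproof M N X (g : rhom N X) (f : rhom M N) x a :
  (g \o f)%VF (ract x a) = ract ((g \o f)%VF x) a.
Proof. by rewrite !comp_lfunE !homE. Qed.
Definition compr M N X (g : rhom N X) (f : rhom M N) : rhom M X :=
  mkhom (comp_hom_subproof g f).
Lemma comprE M N X (g : rhom N X) (f : rhom M N) x : compr g f x = g (f x).
Proof. by rewrite comp_lfunE. Qed.

Fact id_hom_subproof M (x : M) a :
  (\1%VF : 'End(M)) (ract x a) = ract ((\1%VF : 'End(M)) x) a.
Proof. by rewrite !id_lfunE. Qed.
Definition idr M : rhom M M := mkhom (@id_hom_subproof M).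
Lemma idrE M (x : M) : idr M x = x.
Proof. by rewrite id_lfunE. Qed.

Definition zeror M N : rhom M N := (0 : subvs_of (homs M N)).
Lemma zerorE M N x : zeror M N x = 0.
Proof. by rewrite zero_lfunE. Qed.

Definition addr_hom M N (f g : rhom M N) : rhom M N :=
  ((f : subvs_of (homs M N)) + (g : subvs_of (homs M N))).
Lemma addrE M N (f g : rhom M N) x : addr_hom f g x = f x + g x.
Proof. by rewrite add_lfunE. Qed.

Definition subr_hom M N (f g : rhom M N) : rhom M N :=
  ((f : subvs_of (homs M N)) - (g : subvs_of (homs M N))).
Lemma subrE M N (f g : rhom M N) x : subr_hom f g x = f x - g x.
Proof. by rewrite /hom_lfun linearB /= add_lfunE opp_lfunE. Qed.

Definition rhomE := (comprE, idrE, zerorE, addrE, subrE).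

Lemma act_ex M (x : M) : exists g : rhom (reg A) M, forall a, g a = ract x a.
Proof.
apply: (hom_ex (f := fun a : reg A => ract x a)) => [k a b|a b].
  exact: ractPr.
exact: ractM.
Qed.

Definition inj M N (f : rhom M N) := forall x, f x = 0 -> x = 0.
Definition surj M N (f : rhom M N) := forall y, exists x, f x = y.

Lemma injP M N (f : rhom M N) : injective_hom f <-> inj f.
Proof.
split=> [f0 x fx|fi].
  by apply/eqP; rewrite -memv0 -f0 memv_ker fx.
by apply/eqP; rewrite -subv0; apply/subvP=> x; rewrite memv_ker memv0 => /eqP/fi->.
Qed.

Lemma surjP M N (f : rhom M N) : surjective_hom f <-> surj f.
Proof.
split=> [fs y|fs].
  have : y \in limg f by rewrite fs memvf.
  by case/memv_imgP=> x _ ->; exists x.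
apply/eqP; rewrite eqEsubv subvf; apply/subvP=> y _.
by case: (fs y) => x <-; rewrite memv_img ?memvf.
Qed.

Lemma exactP M N X (f : rhom M N) (g : rhom N X) : exact_at f g <->
  (forall x, g (f x) = 0) /\ forall y, g y = 0 -> exists x, f x = y.
Proof.
split=> [fg|[fg gf]].
  split=> [x|y gy]; first by apply/eqP; rewrite -memv_ker -fg memv_img ?memvf.
  have : y \in limg f by rewrite fg memv_ker gy.
  by case/memv_imgP=> x _ ->; exists x.
apply/eqP; rewrite eqEsubv; apply/andP; split; apply/subvP=> y.
  by case/memv_imgP=> x _ ->; rewrite memv_ker fg.
by rewrite memv_ker => /eqP/gf[x <-]; rewrite memv_img ?memvf.
Qed.

Lemma zero_modP M : zero_mod M <-> forall x : M, x = 0.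
Proof.
split=> [M0 x|M0]; first by apply/eqP; rewrite -memv0 -M0 memvf.
by apply/eqP; rewrite -subv0; apply/subvP=> x _; rewrite (M0 x) mem0v.
Qed.

Lemma inj_inj M N (f : rhom M N) : inj f -> forall x y, f x = f y -> x = y.
Proof.
by move=> fi x y xy; apply/eqP; rewrite -subr_eq0; apply/eqP/fi; rewrite homB xy subrr.
Qed.

(** The pseudo-inverse [(i^-1)%VF] is only [K]-linear; its composite with [f] is equivariant because
    [i] is equivariant and injective. *)
Lemma lift_ex M N X (i : rhom M N) (f : rhom X N) :
  inj i -> (forall x, exists y, i y = f x) ->
  exists g : rhom X M, forall x, i (g x) = f x.
Proof.
move=> ii im; have imf x : i ((i^-1)%VF (f x)) = f x.
  by apply: limg_lfunVK; case: (im x) => y <-; rewrite memv_img ?memvf.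
have [||g gE] := @hom_ex X M (fun x => (i^-1)%VF (f x)).
- by move=> k x y; rewrite !linearP.
- by move=> x a; apply: (inj_inj ii); rewrite imf !homE imf.
by exists g => x; rewrite gE imf.
Qed.

(** A [K]-linear section of [q] suffices: as [f] kills the kernel of [q], its value does not depend
    on the preimage chosen, whence equivariance. *)
Lemma desc_ex M N X (q : rhom M N) (f : rhom M X) :
  surj q -> (forall x, q x = 0 -> f x = 0) ->
  exists g : rhom N X, forall x, g (q x) = f x.
Proof.
move=> sq qf; have qK y : q ((q^-1)%VF y) = y.
  by apply: limg_lfunVK; case: (sq y) => x <-; rewrite memv_img ?memvf.
have fq x y : q x = q y -> f x = f y.
  move=> xy; apply/eqP; rewrite -subr_eq0 -homB; apply/eqP/qf.
  by rewrite homB xy subrr.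
have [||g gE] := @hom_ex N X (fun x => f ((q^-1)%VF x)).
- by move=> k x y; rewrite !linearP.
- by move=> x a; rewrite -homE; apply: fq; rewrite homE !qK.
by exists g => x; rewrite gE; apply: fq; rewrite qK.
Qed.

Lemma bij_inv M N (f : rhom M N) : inj f -> surj f ->
  exists g : rhom N M, (forall x, g (f x) = x) /\ forall y, f (g y) = y.
Proof.
move=> fi fs; have [g gE] := desc_ex (f := idr M) fs
  (fun x (h : f x = 0) => etrans (idrE x) (fi x h)).
have gf x : g (f x) = x by rewrite gE rhomE.
by exists g; split=> // y; case: (fs y) => x <-; rewrite gf.
Qed.

Lemma inj_surj M (f : rhom M M) : inj f -> surj f.
Proof.
move/injP=> fi; apply/surjP; apply/eqP; rewrite eqEdim subvf.
by rewrite limg_dim_eq; first exact: leqnn; rewrite capfv fi.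
Qed.

Lemma surj_inj M (f : rhom M M) : surj f -> inj f.
Proof.
move/surjP=> fs; apply/injP; apply/eqP; rewrite -dimv_eq0.
have := limg_ker_dim f fullv; rewrite capfv fs => /eqP.
by rewrite -[X in _ == X]add0n eqn_add2r.
Qed.
End Modules.

(** * Kernels, quotients, sums and projective modules *)

Section Constructions.
Variables (K : fieldType) (A : falgType K).
Implicit Types M N P Q X Y Z : rmod A.

Lemma vsvalP (V : vectType K) (U : {vspace V}) k (x y : subvs_of U) :
  vsval (k *: x + y) = k *: vsval x + vsval y.
Proof. exact: linearP. Qed.

Lemma sub_ex M (U : {vspace M}) : submodule U ->
  exists (S : rmod A) (i : rhom S M), inj i /\ limg i = U.
Proof.
move=> sU; pose act (x : subvs_of U) a : subvs_of U := Subvs (sU _ a (subvsP x)).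
have act1 a : linear (fun x => act x a).
  by move=> k x y; apply/subvs_inj; apply: etrans (esym (vsvalP k _ _));
     apply: etrans (ractPl k _ _ a); congr (ract _ a); exact: vsvalP.
have act2 x : linear (act x).
  by move=> k a b; apply/subvs_inj; apply: etrans (esym (vsvalP k _ _)); exact: ractPr.
have act3 x : act x 1 = x by apply/subvs_inj; rewrite /= ract1.
have act4 x a b : act x (a * b) = act (act x a) b.
  by apply/subvs_inj; rewrite /= ractM.
pose S := RMod act1 act2 act3 act4.
have [||i iE] := @hom_ex K A S M (fun x : subvs_of U => vsval x).
- by move=> k x y; exact: vsvalP.
- by [].
exists S, i; split=> [x|]; first by rewrite iE => x0; apply/subvs_inj; rewrite linear0.
apply/eqP; rewrite eqEsubv; apply/andP; split; apply/subvP=> y.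
  by case/memv_imgP=> x _ ->; rewrite iE subvsP.
by move=> yU; rewrite -[y]/(vsval (Subvs yU)) -iE memv_img ?memvf.
Qed.

(** The quotient is carried by a linear complement [W] of [U]: act in [M], then project back to [W]
    along [U]. *)
Lemma quot_ex M (U : {vspace M}) : submodule U ->
  exists (Q : rmod A) (q : rhom M Q), surj q /\ forall x, q x = 0 <-> x \in U.
Proof.
move=> sU; pose W := (U^C)%VS.
have fP x : x - projv U x \in W by exact: memv_projC.
pose g x : subvs_of W := vsproj W (x - projv U x).
have gl : linear g.
  by move=> k x y; rewrite /g -linearP; congr (vsproj _ _);
     rewrite linearP scalerBr opprD addrACA.
pose f := mklfun gl.
have f0 x : f x = 0 <-> x \in U.
  rewrite mklfunE; split=> [fx|xU]; last by rewrite /g projv_id // subrr linear0.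
  move/(congr1 vsval): fx; rewrite vsprojK ?fP // linear0 => /eqP.
  by rewrite subr_eq0 => /eqP ->; exact: memv_proj.
have fK (y : subvs_of W) : f (vsval y) = y.
  apply/subvs_inj; rewrite mklfunE vsprojK ?fP //.
  suff -> : projv U (vsval y) = 0 by rewrite subr0.
  apply/eqP; rewrite -memv0 -(capv_compl U) memv_cap memv_proj /=.
  have := rpredB (subvsP y) (fP (vsval y)).
  by rewrite opprB addrC subrK.
have fE x y : x - y \in U -> f x = f y.
  by move=> /f0; rewrite linearB => /eqP; rewrite subr_eq0 => /eqP.
have fvK x : vsval (f x) - x \in U by apply/f0; rewrite linearB /= fK subrr.
pose act (y : subvs_of W) a : subvs_of W := f (ract (vsval y) a).
have act1 a : linear (fun x => act x a).
  by move=> k x y; rewrite /act -(linearP f); congr (f _);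
     apply: etrans (ractPl k _ _ a); congr (ract _ a); exact: vsvalP.
have act2 x : linear (act x).
  by move=> k a b; rewrite /act ractPr linearP.
have act3 x : act x 1 = x by rewrite /act ract1 fK.
have act4 x a b : act x (a * b) = act (act x a) b.
  by rewrite /act ractM; apply/esym/fE; rewrite -ractBl; apply: sU.
pose Q := RMod act1 act2 act3 act4.
have [||q qE] := @hom_ex K A M Q f; first exact: linearP.
  by move=> x a; rewrite /= /act; apply/esym/fE; rewrite -ractBl; apply: sU.
exists Q, q; split=> [y|x]; last by rewrite qE.
by exists (vsval (y : subvs_of W)); rewrite qE fK.
Qed.

Lemma sum_mod_ex M N : exists (S : rmod A) (i : rhom M S) (j : rhom N S)
  (p : rhom S M) (q : rhom S N),
  [/\ forall x, p (i x) = x, forall y, p (j y) = 0, forall x, q (i x) = 0,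
      forall y, q (j y) = y & forall z, z = i (p z) + j (q z)].
Proof.
pose act (z : M * N) a : M * N := (ract z.1 a, ract z.2 a).
have act1 a : linear (fun z => act z a).
  by move=> k [x1 x2] [y1 y2]; rewrite /act /= !ractPl.
have act2 x : linear (act x) by move=> k a b; rewrite /act !ractPr.
have act3 x : act x 1 = x by case: x => x y; rewrite /act !ract1.
have act4 x a b : act x (a * b) = act (act x a) b by rewrite /act !ractM.
pose S := RMod act1 act2 act3 act4.
have [||i iE] := @hom_ex K A M S (fun x => (x, 0)).
- by move=> k x y; congr pair; rewrite /= scaler0 addr0.
- by move=> x a; rewrite /= /act /= ract0l.
have [||j jE] := @hom_ex K A N S (fun x => (0, x)).
- by move=> k x y; congr pair; rewrite /= scaler0 addr0.
- by move=> x a; rewrite /= /act /= ract0l.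
have [//|//|p pE] := @hom_ex K A S M (fun z => z.1).
have [//|//|q qE] := @hom_ex K A S N (fun z => z.2).
exists S, i, j, p, q; split=> [x|x|x|x|z]; rewrite ?(pE, qE) ?(iE, jE) //.
by case: z => x y; congr pair; rewrite /= ?addr0 ?add0r.
Qed.

Lemma ker_sub M N (f : rhom M N) : submodule (lker f).
Proof. by move=> x a; rewrite !memv_ker homE => /eqP->; rewrite ract0l. Qed.
Lemma img_sub M N (f : rhom M N) : submodule (limg f).
Proof.
by move=> x a /memv_imgP[y _ ->]; rewrite -homE memv_img ?memvf.
Qed.

#[global] Arguments ker_sub {M N} f.
#[global] Arguments img_sub {M N} f.

Lemma ker_ex M N (f : rhom M N) : exists (S : rmod A) (i : rhom S M),
  inj i /\ forall x, f x = 0 <-> exists y, i y = x.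
Proof.
have [S [i [ii iE]]] := sub_ex (ker_sub f); exists S, i; split=> // x.
split=> [fx|[y <-]]; last first.
  by apply/eqP; rewrite -memv_ker -iE memv_img ?memvf.
have : x \in limg i by rewrite iE memv_ker fx.
by case/memv_imgP=> y _ ->; exists y.
Qed.

Lemma img_ex M N (f : rhom M N) : exists (S : rmod A) (e : rhom M S) (i : rhom S N),
  [/\ surj e, inj i & forall x, i (e x) = f x].
Proof.
have [S [i [ii iE]]] := sub_ex (img_sub f).
have fS y : y \in limg f -> exists s, i s = y.
  by rewrite -iE => /memv_imgP[s _ ->]; exists s.
have [e eE] := lift_ex ii (fun x => fS _ (memv_img f (memvf x))).
exists S, e, i; split=> // s.
have : i s \in limg f by rewrite -iE memv_img ?memvf.
by case/memv_imgP=> x _ xs; exists x; apply: (inj_inj ii); rewrite eE.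
Qed.

Lemma coker_ex M N (f : rhom M N) : exists (Q : rmod A) (q : rhom N Q),
  surj q /\ forall y, q y = 0 <-> exists x, f x = y.
Proof.
have [Q [q [sq qE]]] := quot_ex (img_sub f); exists Q, q; split=> // y.
rewrite qE; split=> [/memv_imgP[x _ ->]|[x <-]]; first by exists x.
by rewrite memv_img ?memvf.
Qed.

Lemma zero_mod_ex : exists Z : rmod A, forall x : Z, x = 0.
Proof.
have [|Q [q [sq qE]]] := @quot_ex (reg A) fullv.
  by move=> x a _; rewrite memvf.
exists Q => y; case: (sq y) => x <-; apply/qE; exact: memvf.
Qed.

(** Only the image of [h] has to lie in that of [g]: the lifting takes place along the corestriction
    of [g] to its image. *)
Lemma proj_lift P X Y (g : rhom X Y) (h : rhom P Y) : projective P ->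
  (forall x, exists y, g y = h x) -> exists k : rhom P X, forall x, g (k x) = h x.
Proof.
move=> pP hg; have [S [e [i [se ii ie]]]] := img_ex g.
have [|h' h'E] := lift_ex (f := h) ii.
  by move=> x; case: (hg x) => y <-; exists (e y).
have [k kE] := pP _ _ e h' (proj2 (surjP e) se).
by exists k => x; rewrite -ie -kE h'E.
Qed.

Lemma free_ex n : exists (F : rmod A) (e : 'I_n -> F) (c : 'I_n -> rhom F (reg A)),
  (forall z, z = \sum_i ract (e i) (c i z))
  /\ forall i j, c i (e j) = (if i == j then 1 else 0).
Proof.
pose act (z : {ffun 'I_n -> A}) a : {ffun 'I_n -> A} := [ffun i => z i * a].
have act1 a : linear (fun z => act z a).
  by move=> k x y; apply/ffunP=> i; rewrite !ffunE mulrDl scalerAl.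
have act2 x : linear (act x).
  by move=> k x' y; apply/ffunP=> i; rewrite !ffunE mulrDr scalerAr.
have act3 x : act x 1 = x by apply/ffunP=> i; rewrite !ffunE mulr1.
have act4 x a b : act x (a * b) = act (act x a) b.
  by apply/ffunP=> i; rewrite !ffunE mulrA.
pose F := RMod act1 act2 act3 act4.
have c_ex i : {c : rhom F (reg A) | forall z : {ffun 'I_n -> A}, c z = z i}.
  have l : linear (fun z : F => (z : {ffun 'I_n -> A}) i : reg A).
    by move=> k x y; rewrite /= !ffunE.
  have h x a : mklfun l (ract x a) = ract (mklfun l x) a.
    by rewrite !mklfunE /= ffunE.
  by exists (mkhom h) => z; rewrite mklfunE.
exists F, (fun j => [ffun i => if i == j then 1 else 0]), (fun i => sval (c_ex i)).
split=> [z|i j]; last by rewrite (svalP (c_ex i)) ffunE.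
apply/ffunP=> j; rewrite sum_ffunE (bigD1 j) //= big1 => [|i /negPf ij].
  by rewrite ffunE (svalP (c_ex j)) ffunE eqxx mul1r addr0.
by rewrite ffunE ffunE eq_sym ij mul0r.
Qed.

Lemma comb_ex n X M (c : 'I_n -> rhom X (reg A)) (x : 'I_n -> M) :
  exists f : rhom X M, forall z, f z = \sum_i ract (x i) (c i z).
Proof.
apply: (hom_ex (f := fun z => \sum_i ract (x i) (c i z))) => [k z w|z a].
  rewrite scaler_sumr -big_split; apply: eq_bigr => i _.
  by rewrite linearP ractPr.
by rewrite ract_suml; apply: eq_bigr => i _; rewrite homE /= ractM.
Qed.

(** An equational form of projectivity. Unlike the lifting property, it carries over directly to
    [star P] and across the change of base algebra [unop]. *)
Definition dual_basis P n (x : 'I_n -> P) (f : 'I_n -> rhom P (reg A)) :=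
  forall y, y = \sum_i ract (x i) (f i y).

Lemma dual_basis_proj P n (x : 'I_n -> P) f : dual_basis x f -> projective P.
Proof.
move=> xf X Y g h /surjP sg.
have /fin_all_exists[y yE] i : exists y, g y = h (x i) by exact: sg.
have [k kE] := comb_ex f y.
exists k => z; rewrite kE hom_sum {1}[z]xf hom_sum; apply: eq_bigr => i _.
by rewrite !homE yE.
Qed.

Lemma free_cover M : exists (F : rmod A) (f : rhom F M) n (e : 'I_n -> F)
   (c : 'I_n -> rhom F (reg A)), dual_basis e c /\ surj f.
Proof.
have [F [e [c [cE ce]]]] := free_ex (\dim (fullv : {vspace M})).
have [f fE] := comb_ex c (fun i => (vbasis (fullv : {vspace M}))`_i).
exists F, f, _, e, c; split=> // y.
pose b := vbasis (fullv : {vspace M}).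
exists (\sum_i ract (e i) (coord b i y *: 1)).
rewrite hom_sum [RHS](coord_vbasis (memvf y)); apply: eq_bigr => i _.
rewrite homE fE (bigD1 i) //= ce eqxx big1 => [|j /negPf ij].
  by rewrite addr0 ractZr !ract1.
by rewrite ce ij ract0r.
Qed.

Lemma projP P : projective P -> exists n (x : 'I_n -> P) f, dual_basis x f.
Proof.
move=> pP; have [F [f [n [e [c [ec sf]]]]]] := free_cover P.
have [s sE] := proj_lift (h := idr P) pP (fun x => sf (idr P x)).
exists n, (fun i => f (e i)), (fun i => compr (c i) s) => y.
rewrite -{1}[y]idrE -sE {1}[s y]ec hom_sum; apply: eq_bigr => i _.
by rewrite homE comprE.
Qed.

Lemma retract_proj P X (s : rhom X P) (r : rhom P X) :
  projective P -> (forall x, r (s x) = x) -> projective X.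
Proof.
move=> pP rs Y Z g h /surjP sg.
have [k kE] := proj_lift (g := g) (h := compr h r) pP (fun x => sg _).
by exists (compr k s) => x; rewrite comprE kE comprE rs.
Qed.

Lemma proj_split P X (e : rhom X P) : projective P -> surj e ->
  exists s : rhom P X, forall x, e (s x) = x.
Proof.
move=> pP se; have [s sE] := proj_lift (h := idr P) pP (fun x => se (idr P x)).
by exists s => x; rewrite sE idrE.
Qed.

Lemma sum_proj P Q S (i : rhom P S) (j : rhom Q S) (p : rhom S P) (q : rhom S Q) :
  projective P -> projective Q -> (forall z, z = i (p z) + j (q z)) -> projective S.
Proof.
move=> pP pQ zE X Y g h /surjP sg.
have [k kE] := proj_lift (g := g) (h := compr h i) pP (fun x => sg _).
have [l lE] := proj_lift (g := g) (h := compr h j) pQ (fun x => sg _).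
exists (addr_hom (compr k p) (compr l q)) => z.
by rewrite !rhomE homD kE lE !comprE -homD -zE.
Qed.

Lemma zero_proj P : (forall x : P, x = 0) -> projective P.
Proof.
by move=> P0 X Y g h _; exists (zeror P X) => x; rewrite zerorE (P0 x) !hom0.
Qed.

Lemma pullback_ex M N X (f : rhom M X) (g : rhom N X) :
  exists (W : rmod A) (p : rhom W M) (q : rhom W N),
  [/\ forall w, f (p w) = g (q w), forall w, p w = 0 -> q w = 0 -> w = 0
    & forall x y, f x = g y -> exists w, p w = x /\ q w = y].
Proof.
have [S [i [j [p [q [pi pj qi qj zE]]]]]] := sum_mod_ex M N.
have [W [k [ki kE]]] := ker_ex (subr_hom (compr f p) (compr g q)).
exists W, (compr p k), (compr q k); split=> [w|w|x y xy].
- have /kE : exists y, k y = k w by exists w.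
  by rewrite !rhomE => /eqP; rewrite subr_eq0 => /eqP.
- by rewrite !comprE => p0 q0; apply: ki; rewrite [k w]zE p0 q0 !hom0 addr0.
have /kE[w wE] : subr_hom (compr f p) (compr g q) (i x + j y) = 0.
  by rewrite !rhomE !homD pi qi pj qj !hom0 addr0 add0r xy subrr.
by exists w; rewrite !comprE wE !homD pi pj qi qj addr0 add0r.
Qed.

Lemma pullback_hom M N X Y W (f : rhom M X) (g : rhom N X) (p : rhom W M) (q : rhom W N)
  (u : rhom Y M) (v : rhom Y N) :
  (forall w, p w = 0 -> q w = 0 -> w = 0) ->
  (forall x y, f x = g y -> exists w, p w = x /\ q w = y) ->
  (forall y, f (u y) = g (v y)) ->
  exists h : rhom Y W, forall y, p (h y) = u y /\ q (h y) = v y.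
Proof.
move=> pq0 pq fg; have [S [i [j [p' [q' [pi pj qi qj zE]]]]]] := sum_mod_ex M N.
have ki : inj (addr_hom (compr i p) (compr j q)).
  move=> w; rewrite !rhomE => w0; apply: pq0.
    by move/(congr1 p'): w0; rewrite homD pi pj addr0 hom0.
  by move/(congr1 q'): w0; rewrite homD qi qj add0r hom0.
have [|h hE] := lift_ex (f := addr_hom (compr i u) (compr j v)) ki.
  by move=> y; have [w [pw qw]] := pq _ _ (fg y); exists w; rewrite !rhomE pw qw.
exists h => y; move: (hE y); rewrite !rhomE => E; split.
  by move/(congr1 p'): E; rewrite !homD !pi !pj !addr0.
by move/(congr1 q'): E; rewrite !homD !qi !qj !add0r.
Qed.

End Constructions.

(** * Projective covers, global dimension two and Ext *)

Section Homological.
Variables (K : fieldType) (A : falgType K).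
Implicit Types M N P Q U V X Y Z : rmod A.

(* See [tightP]: the kernel of [e] is superfluous. *)
Definition tight P M (e : rhom P M) := forall X (g : rhom X P),
  (forall y, exists x, e (g x) = e y) -> surj g.

Lemma tightP P M (e : rhom P M) : superfluous (lker e) <-> tight e.
Proof.
split=> [se X g eg|te W sW We].
  apply/surjP; apply: (se _ (img_sub g)); apply/eqP.
  rewrite eqEsubv subvf; apply/subvP=> y _.
  have [x xy] := eg y; rewrite -[y](subrK (g x)) addrC.
  by rewrite memv_add ?memv_img ?memvf // memv_ker linearB /= xy subrr.
have [S [i [ii iW]]] := sub_ex sW; rewrite -iW; apply/surjP/te => y.
have : y \in (W + lker e)%VS by rewrite We memvf.
case/memv_addP=> w; rewrite -iW => /memv_imgP[x _ ->] [z].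
by rewrite memv_ker => /eqP ez ->; exists x; rewrite homD ez addr0.
Qed.

Lemma tight_surj P M (e : rhom P M) (g : rhom P P) :
  tight e -> (forall x, e (g x) = e x) -> surj g.
Proof. by move=> te eg; apply: te => y; exists y. Qed.

Lemma nat_min (Q : nat -> Prop) : (exists n, Q n) ->
  exists n, Q n /\ forall m, Q m -> (n <= m)%N.
Proof.
case=> n; have [k] := ubnP n; elim: k n => // k IH n nk Qn.
case: (classic (exists2 m, (m < n)%N & Q m)) => [[m mn Qm]|no].
  by apply: (IH m) => //; exact: leq_trans mn _.
by exists n; split=> // m Qm; rewrite leqNgt; apply/negP=> mn; case: no; exists m.
Qed.

Lemma inj_dim S M (i : rhom S M) : inj i -> \dim (fullv : {vspace S}) = \dim (limg i).
Proof. by move=> /injP ii; rewrite limg_dim_eq // capfv ii. Qed.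

(* Take [P] of minimal dimension. If [e] is not tight, then among the endomorphisms [u]
   with [e u = e] one of minimal rank restricts to an automorphism of its image, which
   is therefore a smaller projective module mapping onto [M]. *)
Lemma proj_cover_ex M :
  exists P (e : rhom P M), [/\ projective P, surj e & tight e].
Proof.
pose D n := exists P (e : rhom P M),
  [/\ projective P, surj e & \dim (fullv : {vspace P}) = n].
have [|n [[P [e [pP se dP]]] min]] := @nat_min D.
  have [F [f [n [x [c [b sf]]]]]] := free_cover M.
  by exists (\dim (fullv : {vspace F})), F, f; split=> //; apply: dual_basis_proj b.
exists P, e; split=> // X g eg; apply: NNPP => ng.
have [k kE] := proj_lift (g := compr e g) (h := e) pP
  (fun y => let: ex_intro x xy := eg y in ex_intro _ x (etrans (comprE e g x) xy)).
pose E r := exists u : rhom P P, (forall x, e (u x) = e x) /\ \dim (limg u) = r.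
have [|r [[u [eu du]] minr]] := @nat_min E.
  by exists (\dim (limg (idr P))), (idr P); split=> // x; rewrite idrE.
have [S [u' [i [su ii iu]]]] := img_ex u.
have limu : limg i = limg u.
  apply/eqP; rewrite eqEsubv; apply/andP; split; apply/subvP=> y /memv_imgP[x _ ->].
    by case: (su x) => z <-; rewrite iu memv_img ?memvf.
  by rewrite -iu memv_img ?memvf.
(* [g k] is one of the competing endomorphisms, and it is not onto because [g] is not. *)
have lt : (\dim (limg u) < n)%N.
  apply: (@leq_ltn_trans (\dim (limg (compr g k)))).
    rewrite du; apply: minr; exists (compr g k); split=> // x.
    by rewrite comprE -[RHS]kE comprE.
  rewrite ltnNge; apply/negP=> le; apply: ng => y.
  have /surjP gk : surjective_hom (compr g k).
    by apply/eqP; rewrite eqEdim subvf dP.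
  by have [x <-] := gk y; exists (k x); rewrite comprE.
have uu : limg (compr u u) = limg u.
  apply/eqP; rewrite eqEdim; apply/andP; split.
    by apply/subvP=> y /memv_imgP[x _ ->]; rewrite comprE memv_img ?memvf.
  rewrite du; apply: minr; exists (compr u u); split=> // x.
  by rewrite comprE !eu.
have sui : surj (compr u' i).
  move=> s; have [x <-] := su s.
  have : u x \in limg (compr u u) by rewrite uu memv_img ?memvf.
  case/memv_imgP=> y _; rewrite comprE => uy; exists (u' y).
  by rewrite comprE iu; apply: (inj_inj ii); rewrite !iu uy.
have [w [wu _]] := bij_inv (surj_inj sui) sui.
suff: (n <= \dim (limg u))%N by rewrite leqNgt lt.
apply: min.
exists S, (compr e i); split=> [|m|].
- by apply: (retract_proj (s := i) (r := compr w u') pP) => x;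
     rewrite comprE -[RHS]wu comprE.
- by have [y <-] := se m; exists (u' y); rewrite comprE iu eu.
- by rewrite (inj_dim ii) limu.
Qed.

Definition kernel_of U P M (i : rhom U P) (e : rhom P M) :=
  inj i /\ forall x, e x = 0 <-> exists y, i y = x.

Lemma kernel_of0 U P M (i : rhom U P) (e : rhom P M) : kernel_of i e ->
  forall y, e (i y) = 0.
Proof. by case=> _ k y; apply/k; exists y. Qed.

Lemma kernel_lift U P M X (i : rhom U P) (e : rhom P M) (f : rhom X P) :
  kernel_of i e -> (forall x, e (f x) = 0) ->
  exists g : rhom X U, forall x, i (g x) = f x.
Proof. by case=> ii k ef; apply: lift_ex ii _ => x; apply/k. Qed.

Lemma kernel_exact U P M (i : rhom U P) (e : rhom P M) :
  kernel_of i e <-> inj i /\ exact_at i e.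
Proof.
split=> [[ii k]|[ii /exactP[ei ex]]]; split=> //.
  by apply/exactP; split=> [x|x /k //]; apply: kernel_of0; split.
by move=> x; split=> [/ex //|[y <-]].
Qed.

(** Both projections of the pullback [X] of [f] and [f'] split, so [X] is at once [K1' + P] and
    [K1 + P']; the first form makes it projective, the second makes [K1] a summand of it. *)
Lemma schanuel V K1 P K1' P' (i : rhom K1 P) (f : rhom P V)
    (i' : rhom K1' P') (f' : rhom P' V) :
  kernel_of i f -> surj f -> kernel_of i' f' -> surj f' ->
  projective P -> projective P' -> projective K1' -> projective K1.
Proof.
move=> ki sf ki' sf' pP pP' pK.
have [X [p [q [pq pq0 pqX]]]] := pullback_ex f f'.
have sp : surj p.
  by move=> x; have [y yx] := sf' (f x); have [w [wx _]] := pqX x y (esym yx); exists w.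
have sq : surj q.
  by move=> y; have [x xy] := sf (f' y); have [w [_ wy]] := pqX x y xy; exists w.
have [s qs] := proj_split pP' sq; have [t pt] := proj_split pP sp.
have [|k kE] := pullback_hom (u := i) (v := zeror K1 P') pq0 pqX.
  by move=> y; rewrite (kernel_of0 ki) rhomE hom0.
have [|l lE] := pullback_hom (u := zeror K1' P) (v := i') pq0 pqX.
  by move=> y; rewrite (kernel_of0 ki') rhomE hom0.
have [|r rE] := kernel_lift (f := subr_hom p (compr p (compr s q))) ki.
  by move=> x; rewrite !rhomE homB !pq qs subrr.
have [|m mE] := kernel_lift (f := subr_hom q (compr q (compr t p))) ki'.
  by move=> x; rewrite !rhomE homB -!pq pt subrr.
have pX : projective X.
  apply: (sum_proj (i := l) (j := t) (p := m) (q := p)) => // x.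
  apply/eqP; rewrite -subr_eq0; apply/eqP; apply: pq0; rewrite homB homD.
    by rewrite (lE _).1 pt rhomE add0r subrr.
  by rewrite (lE _).2 mE !rhomE subrK subrr.
apply: (retract_proj (s := k) (r := r) pX) => y.
by apply: (inj_inj ki.1); rewrite rE !rhomE (kE _).1 (kE _).2 !rhomE !hom0 subr0.
Qed.

Lemma sum_hom_ex P Q X S (p : rhom S P) (q : rhom S Q) (f : rhom P X) (g : rhom Q X) :
  exists h : rhom S X, forall z, h z = f (p z) + g (q z).
Proof. by exists (addr_hom (compr f p) (compr g q)) => z; rewrite !rhomE. Qed.

Definition gldim2 := forall M, pd_le 2 M.

(* With [C = coker f] and a resolution [R2 -> R1 -> R0 -> C], apply Schanuel's lemma to
   [U -> P + R0 -> X] and [R2 -> Q + R1 -> X], where [X] is the pullback of [Q] and [R0]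
   over [C]. *)
Lemma ker_proj P Q U (f : rhom P Q) (k : rhom U P) : gldim2 ->
  projective P -> projective Q -> kernel_of k f -> projective U.
Proof.
move=> gl pP pQ kf; have [C [c [sc cE]]] := coker_ex f.
have [R R0] := gl C.
set e := pr_eps R; have /surjP se : surjective_hom e := pr_surj R.
have /exactP[ed exe] := pr_exact0 R.
have /exactP[dd exd] := pr_exactS R 0.
have /exactP[_ exdd] := pr_exactS R 1.
have injd : inj (pr_d R 1).
  move=> x /exdd[y <-]; have /zero_modP R3 := R0 3 isT.
  by rewrite (R3 y) hom0.
have pR j := @pr_proj _ _ _ R j.
have [X [a [b [ab ab0 abX]]]] := pullback_ex c e.
have [si siE] := proj_lift (h := e) (g := c) (pR 0) (fun x => sc (e x)).
have [ta taE] := proj_lift (h := c) (g := e) pQ (fun x => se (c x)).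
have [S [i [j [p [q [pi pj qi qj zE]]]]]] := sum_mod_ex P (pr_mod R 0).
have [S' [i' [j' [p' [q' [pi' pj' qi' qj' zE']]]]]] := sum_mod_ex Q (pr_mod R 1).
have pS : projective S := sum_proj pP (pR 0) zE.
have pS' : projective S' := sum_proj pQ (pR 1) zE'.
have [u uE] := sum_hom_ex p q f si.
have [v vE] := sum_hom_ex p' q' ta (pr_d R 0).
have cf x : c (f x) = 0 by apply/cE; exists x.
(* With [si] and [ta] lifting the augmentations over [C], [ph] sends [(y, r)] to [(f y + si r, r)]
   and [ps] sends [(y, r)] to [(y, ta y + d r)], where [d] is the first differential of [R]. *)
have [|ph phE] := pullback_hom (u := u) (v := q) ab0 abX.
  by move=> y; rewrite uE homD cf siE add0r.
have [|ps psE] := pullback_hom (u := p') (v := v) ab0 abX.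
  by move=> y; rewrite vE homD ed taE addr0.
have extX x y : a x = a y -> b x = b y -> x = y.
  move=> axy bxy; apply/eqP; rewrite -subr_eq0; apply/eqP; apply: ab0.
    by rewrite homB axy subrr.
  by rewrite homB bxy subrr.
have sph : surj ph.
  move=> x; have /cE[y yE] : c (a x - si (b x)) = 0 by rewrite homB siE ab subrr.
  exists (i y + j (b x)); apply: extX.
    by rewrite (phE _).1 uE !homD pi pj qi qj !hom0 !(addr0, add0r) yE subrK.
  by rewrite (phE _).2 homD qi qj add0r.
have sps : surj ps.
  move=> x; have /exe[y yE] : e (b x - ta (a x)) = 0 by rewrite homB taE ab subrr.
  exists (i' (a x) + j' y); apply: extX.
    by rewrite (psE _).1 homD pi' pj' addr0.
  by rewrite (psE _).2 vE !homD pi' pj' qi' qj' !hom0 !(addr0, add0r) yE addrC subrK.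
apply: (@schanuel X U S (pr_mod R 2) S' (compr i k) ph (compr j' (pr_d R 1)) ps) => //.
- split=> [y|x].
    by rewrite comprE => iky; apply: kf.1; rewrite -[k y]pi iky hom0.
  split=> [phx|[y <-]].
    have qx : q x = 0 by rewrite -(phE x).2 phx hom0.
    have : f (p x) = 0 by have := uE x; rewrite -(phE x).1 phx hom0 qx hom0 addr0.
    by case/(kf.2) => y ky; exists y; rewrite comprE ky [x in RHS]zE qx hom0 addr0.
  apply: extX; last by rewrite (phE _).2 comprE qi hom0.
  by rewrite (phE _).1 uE comprE pi qi !hom0 addr0 (kernel_of0 kf).
- split=> [y|x].
    by rewrite comprE => iky; apply: injd; rewrite -[X in X = _]qj' iky hom0.
  split=> [psx|[y <-]].
    have px : p' x = 0 by rewrite -(psE x).1 psx hom0.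
    have : pr_d R 0 (q' x) = 0 by have := vE x; rewrite -(psE x).2 psx hom0 px hom0 add0r.
    by case/exd => y ky; exists y; rewrite comprE ky [x in RHS]zE' px hom0 add0r.
  apply: extX; first by rewrite (psE _).1 comprE pj' hom0.
  by rewrite (psE _).2 vE comprE pj' qj' !hom0 add0r dd.
Qed.

Section Splice.
Variables (U P M : rmod A) (i : rhom U P) (e : rhom P M) (R : proj_res U).
Hypotheses (ki : kernel_of i e) (se : surj e) (pP : projective P).

Definition splice_mod n := if n is m.+1 then pr_mod R m else P.
Definition splice_d n : rhom (splice_mod n.+1) (splice_mod n) :=
  match n with 0 => compr i (pr_eps R) | m.+1 => pr_d R m end.

Fact splice_proj n : projective (splice_mod n).
Proof. by case: n => //= n; apply: pr_proj. Qed.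

Fact splice_exact0 : exact_at (splice_d 0) e.
Proof.
have /surjP sR := pr_surj R; apply/exactP; split=> [x|x /ki.2[u <-]].
  by rewrite /= comprE (kernel_of0 ki).
by have [y <-] := sR u; exists y; rewrite /= comprE.
Qed.

Fact splice_exactS n : exact_at (splice_d n.+1) (splice_d n).
Proof.
case: n => [|n]; last exact: pr_exactS.
have /exactP[e1 e2] := pr_exact0 R; apply/exactP; split=> [x|x].
  by rewrite /= comprE e1 hom0.
by rewrite /= comprE => /ki.1/e2.
Qed.

Definition splice : proj_res M := ProjRes splice_proj (proj2 (surjP e) se)
  splice_exact0 splice_exactS.
End Splice.

Lemma zero_res Z : (forall x : Z, x = 0) ->
  exists R : proj_res Z, forall i, zero_mod (pr_mod R i).
Proof.
move=> Z0; have zE : exact_at (zeror Z Z) (zeror Z Z).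
  by apply/exactP; split=> x; rewrite ?zerorE // => _; exists 0; rewrite hom0 [RHS]Z0.
have se : surjective_hom (zeror Z Z).
  by apply/surjP=> x; exists 0; rewrite hom0 [RHS]Z0.
exists (@ProjRes _ _ Z (fun _ => Z) (fun _ => zeror Z Z) (zeror Z Z)
  (fun _ => zero_proj Z0) se zE (fun _ => zE)) => i /=.
exact/zero_modP.
Qed.

Lemma pd_leS n U P M (i : rhom U P) (e : rhom P M) :
  kernel_of i e -> surj e -> projective P -> pd_le n U -> pd_le n.+1 M.
Proof.
by move=> ki se pP [R R0]; exists (splice R ki se pP) => -[].
Qed.

Lemma pd_le0P M : pd_le 0 M <-> projective M.
Proof.
split=> [[R R0]|pM].
  have /surjP se := pr_surj R; have /exactP[_ ex] := pr_exact0 R.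
  have [|r [_ rE]] := bij_inv (f := pr_eps R) _ se.
    by move=> x /ex[y <-]; have /zero_modP R1 := R0 1 isT; rewrite (R1 y) hom0.
  exact: (retract_proj (pr_proj R 0) rE).
have [Z Z0] := zero_mod_ex A; have [R R0] := zero_res Z0.
have ki : kernel_of (zeror Z M) (idr M).
  split=> [x _|x]; first exact: Z0.
  rewrite idrE; split=> [->|[y <-]]; last by rewrite rhomE.
  by exists 0; rewrite hom0.
have si : surj (idr M) by move=> x; exists x; rewrite idrE.
by exists (splice R ki si pM) => -[] // j _; apply: R0.
Qed.

(** Schanuel's lemma compares [U] with the term of degree 1 in a resolution of length 1. *)
Lemma pd_le1P U P M (i : rhom U P) (e : rhom P M) :
  kernel_of i e -> surj e -> projective P -> (pd_le 1 M <-> projective U).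
Proof.
move=> ki se pP; split=> [[R R0]|/pd_le0P]; last exact: pd_leS ki se pP.
have /surjP sR := pr_surj R; have /exactP[ed ex] := pr_exact0 R.
have /exactP[_ exd] := pr_exactS R 0.
apply: (schanuel ki se _ sR pP (pr_proj R 0) (pr_proj R 1)).
apply/kernel_exact; split; last exact: pr_exact0.
by move=> x /exd[y <-]; have /zero_modP R2 := R0 2 isT; rewrite (R2 y) hom0.
Qed.

Lemma pd_leW m n M : (m <= n)%N -> pd_le m M -> pd_le n M.
Proof.
by move=> mn [R R0]; exists R => i ni; apply: R0; exact: leq_ltn_trans mn ni.
Qed.

(** For a syzygy [i : U -> P] of [M] with [P] projective, this is the vanishing of [Ext^1(M, N)]. *)
Definition extends U P N (i : rhom U P) :=
  forall h : rhom U N, exists g : rhom P N, forall u, g (i u) = h u.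

(** [a] and [b] are comparison maps over [M]. The difference [b a - 1] dies in [M], so it is [i' c];
    subtracting [h' c] corrects the extension transported along [a]. *)
Lemma extends_indep U P U' P' M N (i : rhom U P) (e : rhom P M)
   (i' : rhom U' P') (e' : rhom P' M) :
  kernel_of i e -> surj e -> projective P ->
  kernel_of i' e' -> surj e' -> projective P' ->
  extends N i -> extends N i'.
Proof.
move=> ki se pP ki' se' pP' ext h'.
have [a aE] := proj_lift (h := e') (g := e) pP' (fun x => se (e' x)).
have [b bE] := proj_lift (h := e) (g := e') pP (fun x => se' (e x)).
have [|a' aE'] := kernel_lift (f := compr a i') ki.
  by move=> x; rewrite comprE aE (kernel_of0 ki').
have [|b' bE'] := kernel_lift (f := compr b i) ki'.
  by move=> x; rewrite comprE bE (kernel_of0 ki).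
have [|c cE] := kernel_lift (f := subr_hom (compr b a) (idr P')) ki'.
  by move=> x; rewrite !rhomE homB bE aE subrr.
have [g gE] := ext (compr h' b').
exists (subr_hom (compr g a) (compr h' c)) => u.
have aiu : a (i' u) = i (a' u) by rewrite aE' comprE.
rewrite !rhomE aiu gE comprE -homB; congr (h' _).
apply: (inj_inj ki'.1).
by rewrite homB bE' cE !rhomE aiu opprB addrCA subrr addr0.
Qed.

(** Composition with [d] turns a map on the kernel of the augmentation of [R] into a 1-cocycle, and
    [extends_indep] passes to the given presentation. Conversely, a resolution of [U] supplied by
    [gl] is spliced onto [P]. *)
Lemma ext1P U P M N (i : rhom U P) (e : rhom P M) : gldim2 ->
  kernel_of i e -> surj e -> projective P -> (Ext_zero 1 M N <-> extends N i).
Proof.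
move=> gl ki se pP; split=> [[R HR]|ext].
  have /surjP sR := pr_surj R; have /exactP[ed ex] := pr_exact0 R.
  have [V [j kj]] := ker_ex (pr_eps R).
  apply: (extends_indep kj sR (pr_proj R 0) ki se pP) => h.
  have [|d dE] := kernel_lift (f := pr_d R 0) kj; first exact: ed.
  have /exactP[dd _] := pr_exactS R 0.
  have [|g gE] := HR (compr h d).
    move=> x; suff -> : compr h d (pr_d R 1 x) = h 0 by rewrite hom0.
    by rewrite comprE; congr (h _); apply: kj.1; rewrite dE dd.
  exists g => v; have [x xv] : exists x, pr_d R 0 x = j v by apply/ex/(kernel_of0 kj).
  by rewrite -xv -gE comprE; congr (h _); apply: (inj_inj kj.1); rewrite dE.
have [R _] := gl U; exists (splice R ki se pP) => f f0.
have /surjP sR := pr_surj R; have /exactP[ed ex] := pr_exact0 R.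
have [|h hE] := desc_ex (f := f) sR.
  by move=> x /ex[y <-]; apply: f0.
have [g gE] := ext h.
by exists g => x; rewrite -[LHS]hE -gE [pr_d _ _ _]comprE.
Qed.

(** One direction is splicing. For the other, [F -> P -> N] is compared with [R] by maps [a], [b]
    and a homotopy with [b1 a1 - 1 = s i c + w k]. On [W] the term [s i c] vanishes, so [g a1 - h k]
    extends [h]. *)
Lemma ext2P U P N X (i : rhom U P) (q : rhom P N) : gldim2 ->
  kernel_of i q -> surj q -> projective P -> (Ext_zero 2 N X <-> Ext_zero 1 U X).
Proof.
move=> gl ki sq pP; split=> [[R HR]|[R HR]]; last by exists (splice R ki sq pP).
have /surjP sR := pr_surj R; have /exactP[ed ex] := pr_exact0 R.
have /exactP[dd exd] := pr_exactS R 0.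
have /exactP[dd1 _] := pr_exactS R 1.
have [F [c [pF sc _]]] := proj_cover_ex U; have [W [w kw]] := ker_ex c.
apply/(ext1P _ gl kw sc pF) => h.
have [a0 aE0] := proj_lift (h := q) (g := pr_eps R) pP (fun x => sR (q x)).
have [b0 bE0] := proj_lift (h := pr_eps R) (g := q)
  (pr_proj R 0) (fun x => sq (pr_eps R x)).
have [|a1 aE1] := proj_lift (h := compr a0 (compr i c)) (g := pr_d R 0) pF.
  by move=> x; apply: ex; rewrite !rhomE aE0 (kernel_of0 ki).
have [|b1' bE1'] := kernel_lift (f := compr b0 (pr_d R 0)) ki.
  by move=> x; rewrite !rhomE bE0 ed.
have [b1 bE1] := proj_lift (h := b1') (g := c) (pr_proj R 1) (fun x => sc (b1' x)).
have [|b2 bE2] := kernel_lift (f := compr b1 (pr_d R 1)) kw.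
  by move=> x; apply: ki.1; rewrite comprE bE1 bE1' comprE dd hom0.
have [|g gE] := HR (compr h b2).
  move=> x; suff b20 : b2 (pr_d R 2 x) = 0 by rewrite comprE b20 hom0.
  by apply: kw.1; rewrite bE2 comprE dd1 hom0.
have [|s' sE'] := kernel_lift (f := subr_hom (compr b0 a0) (idr P)) ki.
  by move=> x; rewrite !rhomE homB bE0 aE0 subrr.
have [s sE] := proj_lift (h := s') (g := c) pP (fun x => sc (s' x)).
have [|k kE] := kernel_lift
    (f := subr_hom (subr_hom (compr b1 a1) (idr F)) (compr s (compr i c))) kw.
  move=> x; apply: ki.1; rewrite !rhomE !homB bE1 bE1' comprE aE1 !comprE.
  by rewrite sE sE' !rhomE subrr.
exists (subr_hom (compr g a1) (compr h k)) => u.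
have [r rE] : exists r, pr_d R 1 r = a1 (w u).
  by apply: exd; rewrite aE1 !rhomE (kernel_of0 kw) !hom0.
rewrite !rhomE -rE -gE comprE -homB; congr (h _); apply: (inj_inj kw.1).
rewrite homB bE2 kE !rhomE rE (kernel_of0 kw) !hom0 subr0.
by rewrite opprB addrCA subrr addr0.
Qed.

End Homological.

(** * The transpose and tau-rigidity *)

Lemma separating_form (K : fieldType) (E : vectType K) (V : {vspace E}) (h : E) :
  h \notin V -> exists phi : 'Hom(E, K^o), (forall v, v \in V -> phi v = 0) /\ phi h != 0.
Proof.
move=> hV; pose p x := x - projv V x.
have p0 : p h != 0.
  by apply: contra hV; rewrite subr_eq0 => /eqP ->; exact: memv_proj.
have [j cj] : exists j, coord (vbasis (fullv : {vspace E})) j (p h) != 0.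
  apply/existsP; apply: contraNT p0; rewrite negb_exists => /forallP c0.
  rewrite [p h](coord_vbasis (memvf _)) big1 // => j _.
  by move: (c0 j); rewrite negbK => /eqP->; rewrite scale0r.
have l : linear (fun x => coord (vbasis (fullv : {vspace E})) j (p x) : K^o).
  move=> k x y; have -> : p (k *: x + y) = k *: p x + p y.
    by rewrite /p linearP scalerBr opprD addrACA.
  by rewrite linearP.
exists (mklfun l); split=> [v vV|]; last by rewrite mklfunE.
by rewrite mklfunE /p projv_id // subrr linear0.
Qed.

Section Mult.
Variables (K : fieldType) (A : falgType K).
Implicit Types N P : rmod A.

Fact mult_lin P N (n : N) (u : rhom P (reg A)) : linear (fun x => ract n (u x)).
Proof. by move=> k x y; rewrite linearP ractPr. Qed.
(** The image of the elementary tensor [n (x) u] under [N (x) P^* -> Hom(P, N)], which is bijective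
    for projective [P]. *)
Definition mult P N (n : N) (u : rhom P (reg A)) : 'Hom(P, N) := mklfun (mult_lin n u).

Lemma multE P N (n : N) (u : rhom P (reg A)) x : mult n u x = ract n (u x).
Proof. exact: mklfunE. Qed.

End Mult.

Section Transpose.
Variables (K : fieldType) (A : falgType K).
Implicit Types M N P Q U V X Y Z : rmod A.

Lemma starE P (u v : star P) : (forall x, vsval u x = vsval v x) -> u = v.
Proof. by move=> uv; apply/subvs_inj/lfunP. Qed.

Lemma star_actE P (u : star P) (a : opalg A) x :
  vsval (ract u a) x = (a : A) * (vsval u x : A).
Proof. by rewrite mklfunE. Qed.

Lemma star_mapE M N (d : rhom M N) (w : star N) x :
  vsval (star_map d w) x = vsval w (d x).
Proof. by rewrite !mklfunE. Qed.

Lemma star_sumE P n (u : 'I_n -> star P) x :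
  vsval (\sum_i u i) x = \sum_i vsval (u i) x.
Proof. by rewrite linear_sum sum_lfunE. Qed.

Lemma star_basis P n (x : 'I_n -> P) (f : 'I_n -> rhom P (reg A)) :
  dual_basis x f -> forall u : star P, u = \sum_i ract (f i : star P) (vsval u (x i) : A).
Proof.
move=> b u; apply: starE => y; rewrite star_sumE {1}[y]b linear_sum.
by apply: eq_bigr => i _; rewrite star_actE;
   exact: (homE (u : rhom P (reg A)) (x i) (f i y)).
Qed.

Lemma ev_valE P (x : P) (u : star P) : vsval (ev_val x) u = vsval u x.
Proof. by rewrite mklfunE. Qed.

Lemma star_proj P : projective P -> projective (star P).
Proof.
move=> /projP[n [x [f b]]].
apply: (@dual_basis_proj _ _ _ n (fun i => f i : star P) (fun i => ev_val (x i))) => u.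
rewrite {1}(star_basis b u); apply: eq_bigr => i _.
by rewrite /hom_lfun ev_valE.
Qed.

Section Cokernel.
Variables (P1 P0 N : rmod A) (d : rhom P1 P0).
Hypotheses (pP1 : projective P1) (pP0 : projective P0).

(* [Hom(N, D T)] consists of the balanced forms on [N x T]. Since [T = coker d^*], they
   correspond to the functionals on [Hom(P1, N)] vanishing on the image of
   [Hom(P0, N)]: [phi] yields [(n, [u]) |-> phi (x |-> n u(x))]. *)
Lemma tau_hom_right (T : rmod (opalg A)) (q : rhom (star P1) T) :
  is_cokernel (star_map d) q ->
  (homs N (unop (kdual T)) = 0%VS <->
   forall h : rhom P1 N, exists g : rhom P0 N, forall x, h x = g (d x)).
Proof.
case=> /exactP[qd exq] /surjP sq.
have [n [x [f b]]] := projP pP1; have [m [y [w c]]] := projP pP0.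
split=> [hom0 h|ext].
  pose comp_d (g : 'Hom(P0, N)) := (g \o d)%VF.
  have ld : linear comp_d.
    by move=> k g g'; apply/lfunP=> z; rewrite !(comp_lfunE, add_lfunE, scale_lfunE).
  pose V := (mklfun ld @: homs P0 N)%VS.
  have [|hV] := boolP ((h : 'Hom(P1, N)) \in V).
    case/memv_imgP=> g gh hE; exists (Subvs gh) => z.
    by rewrite hE mklfunE comp_lfunE.
  have [phi [phiV phih]] := separating_form hV.
  pose s (t : T) : rhom P1 (reg A) := ((q^-1)%VF t : star P1).
  have qs t : q (s t) = t.
    by apply: limg_lfunVK; case: (sq t) => z <-; rewrite memv_img ?memvf.
  (* [mult z (d^* v')] factors through [d], so [phi] kills it. *)
  have phiq (z : N) (u v : star P1) : q u = q v -> phi (mult z u) = phi (mult z v).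
    move=> uv; apply/eqP; rewrite -subr_eq0 -linearB; apply/eqP/phiV.
    have [v' v'E] : exists v', star_map d v' = u - v.
      by apply: exq; rewrite homB uv subrr.
    have [g gE] := act_ex z.
    apply/memv_imgP; exists (hom_lfun (compr g (v' : rhom P0 (reg A)))).
      exact: subvsP.
    apply/lfunP=> p; rewrite mklfunE comp_lfunE comprE gE.
    rewrite -[hom_lfun v' (d p)]/(vsval v' (d p)) -star_mapE v'E.
    by rewrite add_lfunE opp_lfunE !multE linearB add_lfunE opp_lfunE ractDr ractNr.
  have l1 (z : N) : linear (fun t : T => phi (mult z (s t)) : K^o).
    move=> k t t'; rewrite -linearP (phiq _ _ (k *: (s t : star P1) + s t')).
      congr (phi _); apply/lfunP=> p; rewrite !(add_lfunE, scale_lfunE, multE).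
      by apply: etrans (ractPr k z _ _); congr (ract z _);
         exact: (hom_lfunP k (s t : star P1) (s t')).
    by rewrite qs linearP /= !qs.
  have [||F FE] := @hom_ex K A N (unop (kdual T)) (fun z => mklfun (l1 z)).
  - move=> k z z'; apply/lfunP=> t; rewrite !(add_lfunE, scale_lfunE, mklfunE) -linearP.
    congr (phi _); apply/lfunP=> p; rewrite !(add_lfunE, scale_lfunE, multE).
    exact: ractPl.
  - move=> z a; apply/lfunP=> t.
    rewrite [RHS]mklfunE !mklfunE (phiq _ (s (ract t a)) (ract (s t : star P1) a)).
      congr (phi _); apply/lfunP=> p; rewrite !multE.
      by rewrite -ractM; congr (ract z _); exact: (star_actE (s t) a p).
    by rewrite homE !qs.
  have phi0 z (u : star P1) : phi (mult z u) = 0.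
    have F0 : hom_lfun F = 0.
      apply/eqP; rewrite -memv0 -hom0; exact: subvsP.
    have := congr1 (fun G : 'Hom(N, unop (kdual T)) => (G z : 'Hom(T, K^o)) (q u)) F0.
    rewrite /= FE !mklfunE zero_lfunE zero_lfunE => <-.
    by apply: phiq; rewrite qs.
  case/eqP: phih; have -> : hom_lfun h = \sum_i mult (h (x i)) (f i).
    apply/lfunP=> p; rewrite sum_lfunE {1}[p]b hom_sum; apply: eq_bigr => i _.
    by rewrite multE homE.
  by rewrite linear_sum big1 // => i _; exact: (phi0 (h (x i)) (f i : star P1)).
apply/eqP; rewrite -subv0; apply/subvP=> F' F'h; rewrite memv0; apply/eqP.
pose F : rhom N (unop (kdual T)) := Subvs F'h.
rewrite -[F']/(hom_lfun F); apply/lfunP=> z; rewrite zero_lfunE; apply/lfunP=> t.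
rewrite [RHS]zero_lfunE; have [u <-] := sq t.
have Fract p a r : (F (ract p a) : 'Hom(T, K^o)) r =
    (F p : 'Hom(T, K^o)) (ract r (a : opalg A)).
  by rewrite homE mklfunE.
have [a aE] := act_ex z.
have [g gE] := ext (compr a (u : rhom P1 (reg A))).
(* To evaluate [F z] at [q u], expand [u] in the dual basis of [P1], replace [z u] by [g d], and
   expand [d (x i)] in the dual basis of [P0]. The sum over [i] then reassembles
   [q (d^* (w j)) = 0]. *)
transitivity (\sum_i (F (g (d (x i))) : 'Hom(T, K^o)) (q (f i))).
  rewrite (star_basis b u) !linear_sum; apply: eq_bigr => i _.
  rewrite -gE comprE aE Fract; congr ((F z : 'Hom(T, K^o)) _).
  exact: (homE q (f i : star P1)).
transitivity (\sum_i \sum_j (F (g (y j)) : 'Hom(T, K^o))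
  (q (ract (f i : star P1) (w j (d (x i)) : A)))).
  apply: eq_bigr => i _; rewrite {1}[d (x i)]c !hom_sum sum_lfunE; apply: eq_bigr => j _.
  rewrite homE Fract; congr ((F (g (y j)) : 'Hom(T, K^o)) _).
  exact: esym (homE q (f i : star P1) _).
rewrite exchange_big big1 // => j _.
rewrite -linear_sum -hom_sum.
have <- : star_map d (w j) = \sum_i ract (f i : star P1) (w j (d (x i)) : A).
  rewrite [LHS](star_basis b); apply: eq_bigr => i _; by rewrite star_mapE.
by rewrite qd linear0.
Qed.

(** Mirror image of [tau_hom_right]: with [M = coker d], the balanced forms on [M x T] are the
    functionals on [Hom(P0^*, T)] that vanish on the image of [Hom(P1^*, T)]; [phi] yields [([p], t)
    |-> phi (u |-> t u(p))]. *)
Lemma tau_hom_left (M : rmod A) (e : rhom P0 M) (T : rmod (opalg A)) :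
  is_cokernel d e ->
  (homs M (unop (kdual T)) = 0%VS <->
   forall h : rhom (star P0) T, exists g : rhom (star P1) T,
     forall x, h x = g (star_map d x)).
Proof.
case=> /exactP[ed exe] /surjP se.
have [n [x [f b]]] := projP pP1; have [m [y [w c]]] := projP pP0.
split=> [hom0 h|ext].
  pose comp_d (g : 'Hom(star P1, T)) := (g \o star_map d)%VF.
  have ld : linear comp_d.
    by move=> k g g'; apply/lfunP=> z; rewrite !(comp_lfunE, add_lfunE, scale_lfunE).
  pose V := (mklfun ld @: homs (star P1) T)%VS.
  have [|hV] := boolP ((h : 'Hom(star P0, T)) \in V).
    case/memv_imgP=> g gh hE; exists (Subvs gh) => z.
    by rewrite hE mklfunE comp_lfunE.
  have [phi [phiV phih]] := separating_form hV.
  pose L (t : T) (z : P0) := mult t (ev_val z : rhom (star P0) (reg (opalg A))).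
  have LE t z (u : star P0) : L t z u = ract t (vsval u z : A).
    by rewrite multE /hom_lfun ev_valE.
  pose s (z : M) : P0 := (e^-1)%VF z.
  have es z : e (s z) = z.
    by apply: limg_lfunVK; case: (se z) => z' <-; rewrite memv_img ?memvf.
  have phie (t : T) (p p' : P0) : e p = e p' -> phi (L t p) = phi (L t p').
    move=> pp'; apply/eqP; rewrite -subr_eq0 -linearB; apply/eqP/phiV.
    have [z zE] : exists z, d z = p - p' by apply: exe; rewrite homB pp' subrr.
    have [g gE] := act_ex t.
    apply/memv_imgP;
      exists (hom_lfun (compr g (ev_val z : rhom (star P1) (reg (opalg A))))).
      exact: subvsP.
    apply/lfunP=> u; rewrite mklfunE comp_lfunE comprE gE.
    rewrite add_lfunE opp_lfunE !LE -ractNr -ractDr; congr (ract t _).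
    by rewrite /hom_lfun ev_valE star_mapE zE linearB.
  have l1 (z : M) : linear (fun t : T => phi (L t (s z)) : K^o).
    move=> k t t'; rewrite -linearP; congr (phi _); apply/lfunP=> u.
    by rewrite !(add_lfunE, scale_lfunE, LE) ractPl.
  have [||F FE] := @hom_ex K A M (unop (kdual T)) (fun z => mklfun (l1 z)).
  - move=> k z z'; apply/lfunP=> t; rewrite !(add_lfunE, scale_lfunE, mklfunE) -linearP.
    rewrite (phie _ _ (k *: s z + s z')); last by rewrite es linearP /= !es.
    congr (phi _); apply/lfunP=> u; rewrite !(add_lfunE, scale_lfunE, LE).
    by rewrite -ractPr linearP.
  - move=> z a; apply/lfunP=> t.
    rewrite [RHS]mklfunE !mklfunE (phie _ _ (ract (s z) a)); last by rewrite homE !es.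
    congr (phi _); apply/lfunP=> u; rewrite !LE -ractM; congr (ract t _).
    exact: (homE (u : rhom P0 (reg A)) (s z) a).
  have phi0 t p : phi (L t p) = 0.
    have F0 : hom_lfun F = 0.
      apply/eqP; rewrite -memv0 -hom0; exact: subvsP.
    have := congr1 (fun G : 'Hom(M, unop (kdual T)) => (G (e p) : 'Hom(T, K^o)) t) F0.
    rewrite /= FE !mklfunE zero_lfunE zero_lfunE => <-.
    by apply: phie; rewrite es.
  case/eqP: phih.
  have -> : hom_lfun h = \sum_j L (h (w j : star P0)) (y j).
    apply/lfunP=> u; rewrite sum_lfunE {1}[u](star_basis c) hom_sum.
    by apply: eq_bigr => j _; rewrite LE homE.
  by rewrite linear_sum big1 // => j _; exact: phi0.
apply/eqP; rewrite -subv0; apply/subvP=> F' F'h; rewrite memv0; apply/eqP.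
pose F : rhom M (unop (kdual T)) := Subvs F'h.
rewrite -[F']/(hom_lfun F); apply/lfunP=> z; rewrite zero_lfunE; apply/lfunP=> t.
rewrite [RHS]zero_lfunE; have [p <-] := se z.
have Fract q a r : (F (ract q a) : 'Hom(T, K^o)) r =
    (F q : 'Hom(T, K^o)) (ract r (a : opalg A)).
  by rewrite homE mklfunE.
have [a aE] := act_ex t.
have [g gE] := ext (compr a (ev_val p : rhom (star P0) (reg (opalg A)))).
transitivity (\sum_j (F (e (y j)) : 'Hom(T, K^o)) (g (star_map d (w j : star P0)))).
  rewrite {1}[p]c !hom_sum sum_lfunE; apply: eq_bigr => j _.
  rewrite homE -gE comprE aE; apply: etrans (Fract _ _ _) _.
  congr ((F (e (y j)) : 'Hom(T, K^o)) (ract t _)).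
  by rewrite /hom_lfun ev_valE.
transitivity (\sum_j \sum_i (F (e (ract (y j) (w j (d (x i)) : A))) : 'Hom(T, K^o))
  (g (f i : star P1))).
  apply: eq_bigr => j _; rewrite (star_basis b (star_map d (w j : star P0))).
  rewrite hom_sum linear_sum.
  apply: eq_bigr => i _; rewrite (homE e); apply: etrans (esym (Fract _ _ _)).
  congr ((F (e (y j)) : 'Hom(T, K^o)) _).
  apply: etrans (homE g (f i : star P1) _) _; congr (ract _ _).
  exact: star_mapE.
rewrite exchange_big big1 // => i _.
transitivity ((F (e (d (x i))) : 'Hom(T, K^o)) (g (f i : star P1))).
  by rewrite [d (x i) in RHS]c !hom_sum sum_lfunE.
by rewrite ed hom0; exact: zero_lfunE.
Qed.
End Cokernel.
End Transpose.

Definition factors (K : fieldType) (A : falgType K) (P1 P0 : rmod A) (d : rhom P1 P0)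
    (N : rmod A) :=
  forall h : rhom P1 N, exists g : rhom P0 N, forall x, h x = g (d x).

Section TauRigid.
Variables (K : fieldType) (A : falgType K).
Implicit Types M N P Q U V X Y Z : rmod A.

Lemma cokerP P1 P0 M (d : rhom P1 P0) (e : rhom P0 M) : is_cokernel d e ->
  [/\ forall x, e (d x) = 0, forall y, e y = 0 -> exists x, d x = y & surj e].
Proof. by case=> /exactP[ed exe] /surjP se. Qed.

(** Tightness of [e] makes the composite comparison map [a' a] onto; tightness of [d] then makes
    [b' b] an automorphism, and its inverse [u] corrects the transported factorization. *)
Lemma factors_minimal P1 P0 P1' P0' M N (d : rhom P1 P0) (e : rhom P0 M)
    (d' : rhom P1' P0') (e' : rhom P0' M) :
  projective P1 -> projective P0 -> is_cokernel d e -> tight e -> tight d ->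
  projective P1' -> projective P0' -> is_cokernel d' e' ->
  factors d' N -> factors d N.
Proof.
move=> pP1 pP0 /cokerP[ed exe se] te td pP1' pP0' /cokerP[ed' exe' se'] fd h.
have [a aE] := proj_lift (h := e) (g := e') pP0 (fun x => se' (e x)).
have [a' aE'] := proj_lift (h := e') (g := e) pP0' (fun x => se (e' x)).
have [|b bE] := proj_lift (h := compr a d) (g := d') pP1.
  by move=> x; apply: exe'; rewrite comprE aE ed.
have [|b' bE'] := proj_lift (h := compr a' d') (g := d) pP1'.
  by move=> x; apply: exe; rewrite comprE aE' ed'.
have sa : surj (compr a' a).
  by apply: tight_surj te _ => x; rewrite comprE aE' aE.
have sb : surj (compr b' b).
  apply: td => y; have [z zE] := sa (d y).
  have [x xE] : exists x, d x = z.
    by apply: exe; rewrite -aE -aE' -(comprE a' a) zE ed.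
  by exists x; rewrite comprE bE' comprE bE comprE xE -(comprE a' a).
have [u [uE _]] := bij_inv (surj_inj sb) sb.
have [g gE] := fd (compr h (compr u b')).
exists (compr g a) => x.
have := gE (b x); rewrite bE !comprE => <-.
by have := uE x; rewrite comprE => ->.
Qed.

Lemma tau_rigidP P1 P0 M (d : rhom P1 P0) (e : rhom P0 M) :
  projective P1 -> projective P0 -> is_cokernel d e -> tight e -> tight d ->
  (tau_rigid M <-> factors d M).
Proof.
move=> pP1 pP0 de te td; split=> [[X [[T [tT isoX]] homX]]|fd].
  case: tT => P1' [P0' [d' [e' [q [pP1' pP0' de' _ qd]]]]].
  apply: (factors_minimal pP1 pP0 de te td pP1' pP0' de').
  apply/(tau_hom_right M pP1' pP0' qd)/eqP; rewrite -subv0; apply/subvP=> F' Fh.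
  rewrite memv0; apply/eqP.
  case: isoX => f [/injP fi /surjP sf].
  have [g [_ gE]] := bij_inv fi sf.
  pose F : rhom M (unop (kdual T)) := Subvs Fh.
  have : hom_lfun (compr g F) \in homs M X by exact: subvsP.
  rewrite homX memv0 => /eqP gF; apply/lfunP=> x.
  rewrite -[LHS]gE -[F' x]/(F x) -(comprE g F) gF !zero_lfunE; exact: hom0.
have [T [q [sq qE]]] := coker_ex (star_map d).
have qd : is_cokernel (star_map d) q.
  split; last exact/surjP.
  by apply/exactP; split=> [x|x /qE //]; apply/qE; exists x.
exists (unop (kdual T)); split; last exact/(tau_hom_right M pP1 pP0 qd).
exists T; split.
  by exists P1, P0, d, e, q; split=> //; split; apply/tightP.
exists (idr _); split; first by apply/injP=> x; rewrite idrE.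
by apply/surjP=> x; exists x; rewrite idrE.
Qed.

Lemma star_left_exact P1 P0 M (d : rhom P1 P0) (e : rhom P0 M) :
  is_cokernel d e -> kernel_of (star_map e) (star_map d).
Proof.
case/cokerP=> ed exe se; split=> [w w0|w].
  apply: starE => x; have [y <-] := se x.
  by rewrite -star_mapE w0 !zero_lfunE.
split=> [w0|[u <-]]; last first.
  apply: starE => x; rewrite !star_mapE ed [RHS]zero_lfunE.
  exact: hom0 (u : rhom M (reg A)).
have [|v vE] := desc_ex (f := w : rhom P0 (reg A)) se.
  move=> x /exe[y <-]; rewrite /hom_lfun -star_mapE w0; exact: zero_lfunE.
by exists v; apply: starE => x; rewrite star_mapE; exact: vE.
Qed.

(* Writing the dual basis of [P1] modulo [im d^*] with elements of [X] gives a map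
   [t : P0 -> P1] such that [1 - t d] is a combination of elements of [X]; it is
   injective because [1 - d t] is, [e] being tight. *)
Lemma star_tight P1 P0 M (d : rhom P1 P0) (e : rhom P0 M) T (q : rhom (star P1) T) :
  projective P1 -> tight e -> (forall x, e (d x) = 0) ->
  (forall u, q u = 0 -> exists w, star_map d w = u) -> tight q.
Proof.
move=> pP1 te ed exq X g gE; have [n [x [f b]]] := projP pP1.
have /fin_all_exists[z zE] i : exists z : X, q (g z) = q (f i : star P1) by exact: gE.
have /fin_all_exists[w wE] i : exists w : star P0,
    star_map d w = (f i : star P1) - g (z i).
  by apply: exq; rewrite homB zE subrr.
have [t tE] := comb_ex (fun i => w i : rhom P0 (reg A)) x.
have [m mE] := comb_ex (fun i => g (z i) : rhom P1 (reg A)) x.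
have tdE y : t (d y) = y - m y.
  rewrite tE {2}[y]b mE -sumrB; apply: eq_bigr => i _.
  rewrite -ractNr -ractDr; congr (ract _ _).
  rewrite /hom_lfun -star_mapE wE.
  exact: etrans (add_lfunE _ _ _) (congr1 _ (opp_lfunE _ _)).
have im : inj m.
  move=> y my; have tdy : t (d y) = y by rewrite tdE my subr0.
  have s1 : surj (subr_hom (idr P0) (compr d t)).
    by apply: tight_surj te _ => v; rewrite !rhomE homB ed subr0.
  have dy : d y = 0 by apply: (surj_inj s1); rewrite !rhomE tdy subrr.
  by rewrite -tdy dy hom0.
have [r [rE _]] := bij_inv im (inj_surj im).
move=> u.
exists (\sum_i ract (z i) (vsval u (r (x i)) : A)).
rewrite hom_sum; apply: starE => y.
rewrite star_sumE -[in RHS](rE y) mE hom_sum.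
rewrite (linear_sum (vsval u)); apply: eq_bigr => i _.
by rewrite !homE star_actE; exact: esym (homE (u : rhom P1 (reg A)) _ _).
Qed.

End TauRigid.

(** * Biduals and presentations through a syzygy *)

Section Bidual.
Variables (K : fieldType) (A : falgType K).
Implicit Types M N P Q U V X Y Z : rmod A.

Lemma unop_hom (X Y : rmod (opalg (opalg A))) (f : rhom X Y) :
  exists g : rhom (unop X) (unop Y), forall x, g x = f x.
Proof.
apply: (@hom_ex _ A (unop X) (unop Y) f) => [k x y|x a]; first exact: linearP.
exact: (@homE _ (opalg (opalg A)) X Y f x a).
Qed.

Lemma unop_proj (X : rmod (opalg (opalg A))) : projective X -> projective (unop X).
Proof.
move=> /projP[n [x [f b]]].
have /fin_all_exists[g gE] i : exists g : rhom (unop X) (reg A), forall x, g x = f i x.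
  apply: (@hom_ex _ A (unop X) (reg A) (f i)) => [k y z|y a]; first exact: linearP.
  exact: (@homE _ (opalg (opalg A)) _ _ (f i) y a).
have bu : @dual_basis _ A (unop X) n x g.
  by move=> y; rewrite {1}[y]b; apply: eq_bigr => i _; rewrite gE.
exact: dual_basis_proj bu.
Qed.

(** A free presentation [G -> F -> M^* -> 0] dualizes to an exact sequence
    [0 -> M^** -> F^* -> G^*], a kernel between projectives. *)
Lemma bidual_proj M : gldim2 A -> projective (bidual M).
Proof.
move=> gl; have [F [f [n [e [c [b sf]]]]]] := free_cover (star M).
have [W [k [ki kE]]] := ker_ex f.
have [G [g [m [e' [c' [b' sg]]]]]] := free_cover W.
have cok : is_cokernel (compr k g) f.
  split; last exact/surjP.
  apply/exactP; split=> [x|x /kE[y <-]]; first by rewrite comprE; apply/kE; exists (g x).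
  by have [z <-] := sg y; exists z; rewrite comprE.
have [ii kerE] := star_left_exact cok.
have [i iE] := unop_hom (star_map f); have [d dE] := unop_hom (star_map (compr k g)).
apply: (@ker_proj _ _ _ _ _ d i gl).
- exact/unop_proj/star_proj/(dual_basis_proj b).
- exact/unop_proj/star_proj/(dual_basis_proj b').
split=> [x|x]; first by rewrite iE; exact: ii.
rewrite dE; split=> [/kerE[y yE]|[y yE]]; first by exists y; rewrite iE.
by apply/kerE; exists y; rewrite -iE.
Qed.

Lemma tight_inj U P X (i : rhom U P) (c : rhom X U) :
  inj i -> tight c -> tight (compr i c).
Proof.
move=> ii tc Y g gE; apply: tc => y; have [x xE] := gE y; exists x.
by apply: (inj_inj ii); move: xE; rewrite !comprE.
Qed.

Lemma kernel_coker U P0 M X (i : rhom U P0) (e : rhom P0 M) (c : rhom X U) :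
  kernel_of i e -> surj e -> surj c -> is_cokernel (compr i c) e.
Proof.
move=> ki se sc; split; last exact/surjP.
apply/exactP; split=> [x|x /ki.2[u <-]]; first by rewrite comprE (kernel_of0 ki).
by have [y <-] := sc u; exists y; rewrite comprE.
Qed.

Lemma tau_rigid_cover M P1 P0 U (c : rhom P1 U) (i : rhom U P0) (e : rhom P0 M) :
  projective P1 -> projective P0 -> kernel_of i e -> surj e -> surj c ->
  tight e -> tight c -> (tau_rigid M <-> factors (compr i c) M).
Proof.
move=> pP1 pP0 ki se sc te tc.
exact: (tau_rigidP pP1 pP0 (kernel_coker ki se sc) te (tight_inj ki.1 tc)).
Qed.

End Bidual.

(** * Torsion modules and the transpose in grade two *)

Section Grade.
Variables (K : fieldType) (A : falgType K).
Implicit Types M N P Q U V X Y Z : rmod A.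

Definition torsion X := forall (f : rhom X (reg A)) x, f x = 0.

Lemma Ext0_torsion M : Ext_zero 0 M (reg A) -> torsion M.
Proof.
case=> R R0 f x; have /exactP[ed _] := pr_exact0 R.
have /surjP sR := pr_surj R; have [y <-] := sR x.
have <- := R0 (compr f (pr_eps R)) _ y; first by rewrite comprE.
by move=> z; rewrite comprE ed hom0.
Qed.

Lemma proj_sep P : projective P -> forall x : P,
  (forall f : rhom P (reg A), f x = 0) -> x = 0.
Proof.
by move=> /projP[n [y [f b]]] x fx; rewrite [x]b big1 // => i _; rewrite fx ract0r.
Qed.

(** Since [M^* = 0], the map [d^*] is injective, so [P0^* -> P1^*] is a minimal projective
    resolution of [T]. Both rigidity conditions then read [Hom(M, D T) = 0]. *)
Lemma tau_rigid_transpose M (T : rmod (opalg A)) :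
  grade_eq 2 M -> is_transpose M T -> (tau_rigid M <-> tau_rigid T /\ pd_eq 1 T).
Proof.
case=> gM E2 [P1 [P0 [d [e [q [pP1 pP0 de [/tightP te /tightP td] qd]]]]]].
have M0 : torsion M by apply: Ext0_torsion; exact: gM.
have [ed exe se] := cokerP de.
have [sqd exq sq] := cokerP qd.
have di : inj (star_map d).
  move=> w /(star_left_exact de).2[u <-]; apply: starE => x.
  rewrite star_mapE [RHS]zero_lfunE; exact: M0 (u : rhom M (reg A)) _.
have kd : kernel_of (star_map d) q.
  by split=> // x; split=> [/exq //|[y <-]].
have tq : tight q by apply: star_tight pP1 te ed exq.
have pT : pd_eq 1 T.
  (* If [T] were projective, minimality would force [P0^* = 0], hence [P0 = 0] and [M = 0], against
     [Ext^2(M, A) <> 0]. *)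
  split; first by apply: pd_leS kd sq (star_proj pP1) _; apply/pd_le0P/star_proj.
  case=> // /pd_le0P pT; exfalso; apply: E2.
  have [s sE] := proj_split pT sq.
  have ss : surj s.
    have := tq _ (compr s q); move=> h y; have [|x <-] := h _ y.
      by move=> z; exists z; rewrite comprE sE.
    by exists (q x); rewrite comprE.
  have w0 (w : star P0) : w = 0.
    apply: di; have [t tE] := ss (star_map d w).
    have t0 : t = 0 by rewrite -(sE t) tE sqd.
    by rewrite -tE t0 hom0.
  have P00 (x : P0) : x = 0.
    apply: proj_sep pP0 _ _ => f.
    by rewrite /hom_lfun (w0 f); exact: zero_lfunE.
  have [|R R0] := @zero_res _ _ M.
    by move=> x; have [y <-] := se x; rewrite (P00 y) hom0.
  exists R => f _; exists (zeror _ _) => x.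
  by have /zero_modP Z := R0 2; rewrite (Z x) !hom0.
have tauT : tau_rigid T <-> factors (star_map d) T.
  apply: (@tau_rigidP _ _ _ _ _ (star_map d) q) => //; try exact: star_proj.
  by move=> X g gE y; have [x xE] := gE y; exists x; apply: (inj_inj di).
have tauM := tau_rigidP pP1 pP0 de te td.
have right := tau_hom_right M pP1 pP0 qd.
have left := tau_hom_left pP1 pP0 T de.
split=> [/tauM/right/left/tauT //|[/tauT/left/right/tauM]//].
Qed.
End Grade.

(** * Simple modules *)

Section Simple.
Variables (K : fieldType) (A : falgType K).
Implicit Types M N P Q S U V X Y Z : rmod A.

Lemma reg_proj : projective (reg A).
Proof.
move=> X Y g h /surjP sg; have [x xE] := sg (h (1 : A)).
have [k kE] := act_ex x; exists k => a.
by rewrite kE homE xE -homE /= mul1r.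
Qed.

Lemma simple_surj X S (f : rhom X S) x : simple_mod S -> f x != 0 -> surj f.
Proof.
case=> _ sS fx; apply/surjP; case: (sS _ (img_sub f)) => // f0.
by case/eqP: fx; apply/eqP; rewrite -memv0 -f0 memv_img ?memvf.
Qed.

Lemma simple_neq0 S : simple_mod S -> exists x : S, x != 0.
Proof.
case=> nS _; apply: NNPP => S0; apply: nS; apply/zero_modP => x.
by apply: NNPP => x0; apply: S0; exists x; apply/eqP.
Qed.

(** A nonzero quotient of least dimension is simple. *)
Lemma simple_quot_ex X (x : X) : x != 0 ->
  exists S (q : rhom X S), simple_mod S /\ surj q.
Proof.
move=> x0; pose D n := exists S (q : rhom X S),
  [/\ ~ zero_mod S, surj q & \dim (fullv : {vspace S}) = n].
have [|n [[S [q [S0 sq dS]]] min]] := @nat_min D.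
  exists (\dim (fullv : {vspace X})), X, (idr X); split=> // [/zero_modP X0|y].
    by case/eqP: x0.
  by exists y; rewrite idrE.
exists S, q; split=> //; split=> // U sU.
case: (U =P 0%VS) => [|U0]; [by left|right; apply: NNPP => Uf].
have [Q [p [sp pE]]] := quot_ex sU.
have kp : lker p = U.
  by apply/vspaceP=> y; rewrite memv_ker; apply/eqP/idP=> /pE.
have : (n <= \dim (fullv : {vspace Q}))%N.
  apply: min; exists Q, (compr p q); split=> // [/zero_modP Q0|y].
    by apply: Uf; apply/vspaceP=> y; rewrite memvf; apply/pE.
  by have [z <-] := sp y; have [w <-] := sq z; exists w; rewrite comprE.
have := limg_ker_dim p fullv; rewrite capfv kp (proj2 (surjP p) sp) dS => <-.
rewrite -[X in (_ <= X)%N]add0n leq_add2r leqn0 dimv_eq0 => /eqP//.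
Qed.

(** A nonzero submodule of least dimension is simple. *)
Lemma simple_sub_ex X (x : X) : x != 0 ->
  exists S (i : rhom S X), simple_mod S /\ inj i.
Proof.
move=> x0; pose D n := exists S (i : rhom S X),
  [/\ ~ zero_mod S, inj i & \dim (fullv : {vspace S}) = n].
have [|n [[S [i [S0 ii dS]]] min]] := @nat_min D.
  exists (\dim (fullv : {vspace X})), X, (idr X); split=> // [/zero_modP X0|y].
    by case/eqP: x0.
  by rewrite idrE.
exists S, i; split=> //; split=> // U sU.
case: (U =P 0%VS) => [|U0]; [by left|right].
have [W [j [ij jU]]] := sub_ex sU.
have : (n <= \dim (fullv : {vspace W}))%N.
  apply: min; exists W, (compr i j); split=> // [/zero_modP W0|y].
    apply: U0; rewrite -jU; apply/vspaceP=> y; rewrite memv0.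
    apply/memv_imgP/eqP=> [[w _ ->]|->]; first by rewrite (W0 w) hom0.
    by exists 0; rewrite ?memvf ?hom0.
  by rewrite comprE => /ii/ij.
rewrite (inj_dim ij) jU -dS => le.
by apply/eqP; rewrite eqEdim subvf.
Qed.

Lemma bij_proj P M (f : rhom P M) : inj f -> surj f -> projective P -> projective M.
Proof.
move=> fi fs pP; have [g [_ gE]] := bij_inv fi fs.
exact: (retract_proj (s := g) (r := f) pP gE).
Qed.

(* If [P1 -> S] were nonzero, [P0] would be a summand of [P1], and the component
   [f] of [P1 -> P0] on it an endomorphism of [P0] with image in its radical.
   Either the image of [f] is contained in a projective proper submodule (the kernel of
   some [phi : P0 -> A]), and minimality of [P1] is contradicted by lifting, or
   [f^*] is injective, hence bijective, and so is [f]. *)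
Lemma simple_no_loop S P0 P1 U (e : rhom P0 S) (i : rhom U P0) (c : rhom P1 U) :
  gldim2 A -> simple_mod S -> projective P0 -> projective P1 ->
  surj e -> tight e -> kernel_of i e -> surj c -> tight c ->
  forall (h : rhom P1 S) x, h x = 0.
Proof.
move=> gl sS pP0 pP1 se te ki sc tc h x; apply/eqP; apply: contraT => hx.
have sh := simple_surj sS hx.
have [t tE] := proj_lift (h := h) (g := e) pP1 (fun x => se (h x)).
have st : surj t.
  by apply: te => y; have [z zE] := sh (e y); exists z; rewrite tE.
have [s sE] := proj_split pP0 st.
pose f := compr (compr i c) s.
have ef y : e (f y) = 0 by rewrite !comprE (kernel_of0 ki).
(* An injective endomorphism is onto, which is incompatible with [e f = 0]. *)
suff fi : inj f.
  have [z /eqP[]] := simple_neq0 sS; have [y <-] := se z.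
  by have [w <-] := inj_surj fi y.
case: (classic (exists (phi : rhom P0 (reg A)) y, phi y <> 0 /\ forall y, phi (f y) = 0)).
  case=> phi [y [phiy phif]].
  have [I [k kk]] := ker_ex phi.
  have pI : projective I := ker_proj gl pP0 reg_proj kk.
  have ek z : e (k z) = 0.
    apply/eqP; apply: contraT => kz.
    have kz' : compr e k z != 0 by rewrite comprE.
    have sek := simple_surj sS kz'.
    have sk : surj k by
      apply: te => w; have [v vE] := sek (e w); exists v; rewrite -comprE.
    by case: phiy; have [w <-] := sk y; exact: kernel_of0 kk w.
  have [|g gE] := proj_lift (g := compr i c) (h := k) pI.
    move=> z; have /ki.2[u uE] := ek z; have [w wE] := sc u.
    by exists w; rewrite comprE wE.
  have [a aE] := kernel_lift kk phif.
  (* On the summand [P0] of [P1] the inclusion [s] is replaced by [g a], which agrees with it under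
     [c]. Tightness keeps the map onto, so [t g a] is an automorphism and [f = k a] is injective. *)
  have sr : surj (addr_hom (compr g (compr a t)) (subr_hom (idr P1) (compr s t))).
    apply: tight_surj tc _ => z; rewrite !rhomE homD homB.
    have -> : c (g (a (t z))) = c (s (t z)).
      by apply: (inj_inj ki.1); have := gE (a (t z)); rewrite aE !comprE.
    by rewrite addrC subrK.
  have sga : surj (compr t (compr g a)).
    move=> y'; have [z <-] := st y'; have [w <-] := sr z; exists (t w).
    by rewrite !rhomE homD homB sE subrr addr0.
  move=> z; rewrite -aE => /kk.1 az; apply: (surj_inj sga).
  by rewrite !comprE az !hom0.
move=> no z fz; apply: (proj_sep pP0) => w.
(* Once [f^*] is bijective, every form [w] on [P0] factors through [f], and forms separate the
   points of [P0]. *)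
have fsi : inj (star_map f).
  move=> v v0; apply: starE => y; rewrite [RHS]zero_lfunE; apply: NNPP => vy.
  apply: no; exists (v : rhom P0 (reg A)), y; split=> // y'.
  by apply: etrans (esym (star_mapE f v y')) _; rewrite v0; exact: zero_lfunE.
have [v vE] := inj_surj fsi w.
rewrite -vE; apply: etrans (star_mapE f v z) _.
by rewrite fz; exact: hom0 (v : rhom P0 (reg A)).
Qed.

End Simple.

(** * Dominant dimension two *)

Section Dominant.
Variables (K : fieldType) (A : falgType K).
Implicit Types L M N P Q S U V X Y Z T F G : rmod A.
Variables (I0 I1 : rmod A) (eta : rhom (reg A) I0) (delta : rhom I0 I1).
Hypotheses (gl : gldim2 A) (jI0 : injective_mod I0) (jI1 : injective_mod I1)
  (pI0 : projective I0) (pI1 : projective I1) (keta : kernel_of eta delta).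

(** Equivalently, the cokernel of [i] is torsion. *)
Definition dense U X (i : rhom U X) := forall f : rhom X (reg A),
  (forall u, f (i u) = 0) -> forall x, f x = 0.

Definition torsionless X := forall x : X,
  (forall f : rhom X (reg A), f x = 0) -> x = 0.

Lemma inj_ext Q X Y (i : rhom X Y) (h : rhom X Q) : injective_mod Q -> inj i ->
  exists k : rhom Y Q, forall x, k (i x) = h x.
Proof.
move=> jQ ii; have [k kE] := jQ _ _ i h (proj2 (injP i) ii).
by exists k => x; rewrite kE.
Qed.

Lemma torsion_proj X P (f : rhom X P) x : torsion X -> projective P -> f x = 0.
Proof.
by move=> tX pP; apply: (proj_sep pP) => g; rewrite -comprE tX.
Qed.

(** A map [Y -> A -> I0] extends to [X] by injectivity of [I0], and the extension vanishes because
    [I0] is projective. *)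
Lemma torsion_sub X Y (i : rhom Y X) : inj i -> torsion X -> torsion Y.
Proof.
move=> ii tX f y; apply: keta.1.
have [k kE] := inj_ext (compr eta f) jI0 ii.
by rewrite -comprE -kE torsion_proj.
Qed.

Lemma torsion_quot X Y (q : rhom X Y) : surj q -> torsion X -> torsion Y.
Proof. by move=> sq tX f y; have [x <-] := sq y; rewrite -comprE tX. Qed.

Lemma dense_proj U X P (i : rhom U X) (f : rhom X P) : dense i -> projective P ->
  (forall u, f (i u) = 0) -> forall x, f x = 0.
Proof.
move=> di pP fi x; apply: (proj_sep pP) => g; rewrite -comprE.
by apply: di => u; rewrite comprE fi hom0.
Qed.

(** The dual basis reduces to maps [p : U -> A]. Extend [eta p] to [k : X -> I0]; then [delta k]
    kills the dense [U] and has projective target [I1], so it is zero and [k] lands in [A]. *)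
Lemma dense_ext U X P (i : rhom U X) (h : rhom U P) : inj i -> dense i ->
  projective P -> exists g : rhom X P, forall u, g (i u) = h u.
Proof.
move=> ii di /projP[n [y [f b]]].
have ext (p : rhom U (reg A)) : exists g : rhom X (reg A), forall u, g (i u) = p u.
  have [k kE] := inj_ext (compr eta p) jI0 ii.
  have [|g gE] := kernel_lift (f := k) keta.
    move=> x; rewrite -comprE; apply: (dense_proj di pI1) => u.
    by rewrite comprE kE comprE (kernel_of0 keta).
  by exists g => u; apply: (inj_inj keta.1); rewrite gE kE comprE.
have /fin_all_exists[g gE] m : exists g : rhom X (reg A), forall u, g (i u) = f m (h u).
  by have [g gE] := ext (compr (f m) h); exists g => u; rewrite gE comprE.
have [k kE] := comb_ex g y; exists k => u.
by rewrite kE [RHS]b; apply: eq_bigr => m _; rewrite gE.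
Qed.

Lemma ev0P M (x : M) : ev M x = 0 <-> forall f : rhom M (reg A), f x = 0.
Proof.
have evE (u : star M) : vsval (ev M x : star (star M)) u = vsval u x.
  by rewrite mklfunE ev_valE.
split=> [ex f|fx].
  by have := evE f; rewrite ex => <-; exact: zero_lfunE.
apply: (@starE _ _ (star M)) => u; rewrite evE.
by apply: etrans (fx u) _; rewrite zero_lfunE.
Qed.

(** The kernel of [ev N] is torsion: a map from it to [A] extends to [N -> I0], and a map to the
    projective [I0] kills what all forms kill. *)
Lemma torsion_part_ex N : exists T (t : rhom T N),
  [/\ kernel_of t (ev N), torsion T
    & forall x, (forall f : rhom N (reg A), f x = 0) -> exists y, t y = x].
Proof.
have [T [t kt]] := ker_ex (ev N); exists T, t.
split=> [//|f y|x /ev0P/kt.2 //].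
apply: keta.1; have [k kE] := inj_ext (compr eta f) jI0 kt.1.
rewrite -comprE -kE; apply: (proj_sep pI0) => g; rewrite -comprE.
by have /ev0P -> : ev N (t y) = 0 by exact: kernel_of0 kt y.
Qed.

(* For the torsion part [T] of [M = P / U], with preimage [V] in [P], the submodule [U] is
   dense in [V], hence a direct summand; its complement is both torsion and contained
   in [P]. *)
Lemma pd1_torsionless M : pd_le 1 M -> torsionless M.
Proof.
move=> pd; have [P [e [pP se _]]] := proj_cover_ex M.
have [U [i ki]] := ker_ex e; have pU := proj1 (pd_le1P ki se pP) pd.
have [T [t [kt tT tP]]] := torsion_part_ex M.
have [V [a [b [ab ab0 abV]]]] := pullback_ex e t.
have [|j jE] := pullback_hom (u := i) (v := zeror U T) ab0 abV.
  by move=> y; rewrite (kernel_of0 ki) rhomE hom0.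
have bU v : b v = 0 -> exists u, j u = v.
  move=> bv; have /ki.2[u uE] : e (a v) = 0 by rewrite ab bv hom0.
  exists u; apply/eqP; rewrite -subr_eq0; apply/eqP/ab0; rewrite homB.
    by rewrite (jE u).1 uE subrr.
  by rewrite (jE u).2 bv zerorE subrr.
have sb : surj b.
  by move=> y; have [x xE] := se (t y); have [v [_ vE]] := abV _ _ xE; exists v.
have dj : dense j.
  move=> f fj v; have [|g <-] := desc_ex (f := f) sb; last exact: tT.
  by move=> x /bU[u <-].
have ij : inj j.
  by move=> u ju; apply: ki.1; rewrite -(jE u).1 ju hom0.
have [r rE] := dense_ext (idr U) ij dj pU.
move=> x /tP[y <-]; have [v <-] := sb y.
have av : subr_hom a (compr a (compr j r)) v = 0.
  by apply: (dense_proj dj pP) => u; rewrite !rhomE rE idrE subrr.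
have bjr : b (j (r v)) = 0 by rewrite (jE _).2 zerorE.
suff -> : v = j (r v) by rewrite bjr hom0.
have ia w : a w = 0 -> w = 0.
  by move=> aw; apply: ab0 => //; apply: kt.1; rewrite -ab aw hom0.
apply/eqP; rewrite -subr_eq0; apply/eqP/ia; rewrite homB.
by move: av; rewrite !rhomE.
Qed.

(* [G] is the double annihilator closure of [N] in [N^**]. *)
Lemma torsionless_closure N : torsionless N ->
  exists G (i : rhom N G), [/\ projective G, inj i & dense i].
Proof.
move=> tN; have pB X : projective (bidual X) := @bidual_proj _ _ X gl.
have [C [c [sc cE]]] := coker_ex (ev N).
have [G [k kk]] := ker_ex (compr (ev C) c).
have [|i iE] := kernel_lift (f := ev N) kk.
  by move=> x; rewrite comprE (_ : c _ = 0) ?hom0 //; apply/cE; exists x.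
have evi x : ev N x = 0 -> x = 0 by move/ev0P/tN.
exists G, i; split.
- by apply: (ker_proj gl (pB _) (pB _) kk).
- by move=> x ix; apply: evi; rewrite -iE ix hom0.
(* Extended to [l : N^** -> I0], the form [f] kills [N] and so factors through [C]. As [I0] is
   projective, the factor kills the torsion part of [C], where [G] lands. *)
move=> f fi g; apply: keta.1.
have [l lE] := inj_ext (compr eta f) jI0 kk.1.
rewrite -comprE -lE.
have [|m mE] := desc_ex (f := l) sc.
  by move=> y /cE[x <-]; rewrite -iE lE comprE fi hom0.
rewrite -mE; apply: (proj_sep pI0) => h; rewrite -comprE.
have /ev0P -> // : ev C (c (k g)) = 0.
by rewrite -comprE (kernel_of0 kk).
Qed.

(** The syzygy of [N] is the kernel of [P -> N -> N^**], a map between projectives. *)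
Lemma torsionless_pd1 N : torsionless N -> pd_le 1 N.
Proof.
move=> tN; have [P [e [pP se _]]] := proj_cover_ex N.
have [U [i ki]] := ker_ex e; apply/(pd_le1P ki se pP).
have evi x : ev N x = 0 -> x = 0 by move/ev0P/tN.
apply: (@ker_proj _ _ _ _ _ (compr (ev N) e) i gl pP (bidual_proj (M := N) gl)).
split=> [|x]; first exact: ki.1.
rewrite comprE; split=> [/evi/ki.2 //|[u <-]].
by rewrite (kernel_of0 ki) hom0.
Qed.

Lemma simple_torsion_pd2 S : simple_mod S -> torsion S -> pd_eq 2 S.
Proof.
move=> sS tS; split; first exact: gl.
move=> m pd; rewrite ltnNge; apply/negP=> m1.
have [x /eqP[]] := simple_neq0 sS.
by apply: (pd1_torsionless (pd_leW m1 pd)) => f; apply: tS.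
Qed.

(* [h] extends to a map from [P1] to [I0], which induces [l : P0 -> I1]; the pullback [W]
   of [l] along [delta] is projective. If [W -> P0] splits, the extension can be
   corrected to take values in [A]; otherwise [W -> P0] lifts to [P1]. *)
Lemma left_almost_split S P0 P1 U U2 (e : rhom P0 S) (i : rhom U P0) (c : rhom P1 U)
    (j : rhom U2 P1) (h : rhom U2 (reg A)) :
  simple_mod S -> projective P0 -> projective P1 ->
  tight e -> kernel_of i e -> surj c -> tight c -> kernel_of j c ->
  (exists g : rhom P1 (reg A), forall u, g (j u) = h u) \/
  (exists v : rhom (reg A) U2, inj (compr v h)).
Proof.
move=> sS pP0 pP1 te ki sc tc kj.
have [k kE] := inj_ext (compr eta h) jI0 kj.1.
have [|l' lE'] := desc_ex (f := compr delta k) sc.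
  by move=> x /kj.2[u <-]; rewrite comprE kE comprE (kernel_of0 keta).
have [l lE] := inj_ext l' jI1 ki.1.
have [D [i1 [j1 [p1 [q1 [pi pj qi qj zE]]]]]] := sum_mod_ex I0 P0.
have [W [w kw]] := ker_ex (subr_hom (compr delta p1) (compr l q1)).
have pW : projective W by apply: ker_proj kw => //; exact: sum_proj pI0 pP0 zE.
have pq z : delta (p1 (w z)) = l (q1 (w z)).
  by have := kernel_of0 kw z; rewrite !rhomE => /eqP; rewrite subr_eq0 => /eqP.
case: (classic (surj (compr q1 w))) => sr.
  left; have [s sE] := proj_split pP0 sr.
  have [|g gE] := kernel_lift
      (f := subr_hom k (compr p1 (compr w (compr s (compr i c))))) keta.
    move=> x; rewrite !rhomE homB pq.
    have := sE (i (c x)); rewrite comprE => ->.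
    by rewrite lE lE' comprE subrr.
  exists g => u; apply: (inj_inj keta.1).
  by rewrite gE !rhomE (kernel_of0 kj) !hom0 subr0 kE comprE.
right.
have er z : e (q1 (w z)) = 0.
  apply: NNPP => /eqP ez; apply: sr.
  have ez' : compr e (compr q1 w) z != 0 by rewrite !comprE.
  apply: te => y; have [x xE] := simple_surj sS ez' (e y).
  by exists x; rewrite -comprE.
have [|ka kaE] := proj_lift (g := compr i c) (h := compr q1 w) pW.
  move=> z; have /ki.2[u uE] := er z; have [x xE] := sc u.
  by exists x; rewrite !comprE xE.
(* [J = (k, i c)] maps [P1] to [W], and [io] embeds [A] as the kernel of [W -> P0]. Tightness makes
   [ka J] an automorphism, while [ka io] lands in [U2] and defines [v]; from [J j = io h] one gets
   [j v h = ka J j], which is injective. *)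
have [|J JE] := kernel_lift (f := addr_hom (compr i1 k) (compr j1 (compr i c))) kw.
  by move=> x; rewrite !rhomE !homD pi pj qi qj !hom0 addr0 add0r lE lE' comprE subrr.
have [|io ioE] := kernel_lift (f := compr i1 eta) kw.
  by move=> x; rewrite !rhomE pi qi (kernel_of0 keta) hom0 subr0.
have skJ : surj (compr ka J).
  apply: tight_surj tc _ => x; apply: (inj_inj ki.1).
  have := kaE (J x); rewrite !comprE JE !rhomE homD qi qj add0r => <- //.
have [|v vE] := kernel_lift (f := compr ka io) kj.
  move=> a; apply: ki.1; have := kaE (io a); rewrite !comprE ioE comprE qi => <- //.
exists v => u; rewrite comprE => vhu.
have Jj : J (j u) = io (h u).
  apply: (inj_inj kw.1); rewrite JE ioE !rhomE kE (kernel_of0 kj) !hom0 addr0.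
  by rewrite comprE.
apply: kj.1; apply: (surj_inj skJ); rewrite comprE Jj -comprE -vE vhu hom0 //.
Qed.

(** Extend coordinate by coordinate with [left_almost_split]. If one coordinate fails to extend, [h]
    is a split injection with image in the radical of [P0], which forces [U2 = 0]. *)
Lemma radical_map_extends S P0 P1 U U2 (e : rhom P0 S) (i : rhom U P0) (c : rhom P1 U)
    (j : rhom U2 P1) (h : rhom U2 P0) :
  simple_mod S -> projective P0 -> projective P1 ->
  tight e -> kernel_of i e -> surj c -> tight c -> kernel_of j c ->
  (forall u, e (h u) = 0) -> exists g : rhom P1 P0, forall u, g (j u) = h u.
Proof.
move=> sS pP0 pP1 te ki sc tc kj eh; have [n [y [w b]]] := projP pP0.
case: (classic (forall m, exists g : rhom P1 (reg A), forall u, g (j u) = w m (h u))).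
  case/fin_all_exists=> g gE; have [k kE] := comb_ex g y; exists k => u.
  by rewrite kE [RHS]b; apply: eq_bigr => m _; rewrite gE.
case/not_all_ex_not=> m no.
have [[g gE]|[v iv]] := left_almost_split (compr (w m) h) sS pP0 pP1 te ki sc tc kj.
  by case: no; exists g => u; rewrite gE comprE.
have [r [rE _]] := bij_inv iv (inj_surj iv).
have [s sh] : exists s : rhom P0 U2, forall u, s (h u) = u.
  by exists (compr r (compr v (w m))) => u; rewrite -[RHS]rE !comprE.
have s1 : surj (subr_hom (idr P0) (compr h s)).
  by apply: tight_surj te _ => x; rewrite !rhomE homB eh subr0.
exists (zeror P1 P0) => u; rewrite zerorE; apply/esym; apply: (surj_inj s1).
by rewrite !rhomE sh subrr.
Qed.

(** The syzygy [U] is its own projective cover, so [factors] along the minimal presentation is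
    [extends] along [i]. *)
Lemma rigid_tau_rigid M : pd_le 1 M -> (rigid M <-> tau_rigid M).
Proof.
move=> pd; have [P [e [pP se te]]] := proj_cover_ex M.
have [U [i ki]] := ker_ex e; have pU := proj1 (pd_le1P ki se pP) pd.
have si : surj (idr U) by move=> x; exists x; rewrite idrE.
have ti : tight (idr U).
  by move=> X g gE y; have [x xE] := gE y; exists x; rewrite !idrE in xE.
have H := tau_rigid_cover pU pP ki se si te ti.
have H' := @ext1P _ _ _ _ _ M _ _ gl ki se pP.
split=> [/H' ext|/H fac].
  by apply/H => h; have [g gE] := ext h; exists g => x; rewrite comprE idrE gE.
by apply/H' => h; have [g gE] := fac h; exists g => x; rewrite gE comprE idrE.
Qed.

Lemma rigid_bidual M N (q : rhom (bidual M) N) : pd_le 1 M -> is_cokernel (ev M) q ->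
  (rigid M <-> Ext_zero 2 N M).
Proof.
move=> pd /cokerP[qe exq sq].
have ke : kernel_of (ev M) q.
  split=> [x /ev0P|x]; first exact: pd1_torsionless.
  by split=> [/exq //|[y <-]].
by rewrite (ext2P M gl ke sq (bidual_proj (M := M) gl)).
Qed.

Lemma simple_tau_rigid S : simple_mod S -> tau_rigid S.
Proof.
move=> sS; have [P0 [e [pP0 se te]]] := proj_cover_ex S.
have [U [i ki]] := ker_ex e; have [P1 [c [pP1 sc tc]]] := proj_cover_ex U.
apply/(tau_rigid_cover pP1 pP0 ki se sc te tc) => h.
exists (zeror P0 S) => x; rewrite zerorE.
exact: (simple_no_loop gl sS pP0 pP1 se te ki sc tc).
Qed.

(** * A unique simple module of projective dimension two *)

Section UniqueSimple.
Variable S : rmod A.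
Hypotheses (sS : simple_mod S) (pdS : pd_eq 2 S)
  (uniS : forall S', simple_mod S' -> pd_eq 2 S' -> iso S' S).

Lemma torsion_quot_ex X (x : X) : torsion X -> x != 0 ->
  exists q : rhom X S, surj q.
Proof.
move=> tX /simple_quot_ex[S' [q [sS' sq]]].
have tS' := torsion_quot sq tX.
have [f [_ /surjP sf]] := uniS sS' (simple_torsion_pd2 sS' tS').
exists (compr f q) => y; have [z <-] := sf y; have [w <-] := sq z.
by exists w; rewrite comprE.
Qed.

Lemma torsion_sub_ex X (x : X) : torsion X -> x != 0 ->
  exists i : rhom S X, inj i.
Proof.
move=> tX /simple_sub_ex[S' [i [sS' ii]]].
have tS' := torsion_sub ii tX.
have [f [/injP fi /surjP sf]] := uniS sS' (simple_torsion_pd2 sS' tS').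
have [g [_ gE]] := bij_inv fi sf.
by exists (compr i g) => y; rewrite comprE => /ii gy; rewrite -[y]gE gy hom0.
Qed.

Lemma dense_coker_torsion U X C (i : rhom U X) (q : rhom X C) :
  dense i -> surj q -> (forall u, q (i u) = 0) -> torsion C.
Proof.
move=> di sq qi f y; have [x <-] := sq y; rewrite -comprE.
by apply: di => u; rewrite comprE qi hom0.
Qed.

Lemma pd1_rigid L : indecomposable L -> pd_eq 1 L -> rigid L.
Proof.
move=> [_ indL] [pdL npdL].
have [G [io [pG iio dio]]] := torsionless_closure (pd1_torsionless pdL).
have [N [q [sq qE]]] := coker_ex io.
have qio x : q (io x) = 0 by apply/qE; exists x.
have tN : torsion N := dense_coker_torsion dio sq qio.
have [n n0] : exists n : N, n != 0.
  apply: NNPP => N0; suff /npdL : pd_le 0 L by [].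
  have sio : surj io.
    by move=> y; apply/qE; apply: NNPP => qy; apply: N0; exists (q y); apply/eqP.
  have [r [rE _]] := bij_inv iio sio.
  exact/pd_le0P/(retract_proj (s := io) (r := r) pG rE).
have [pi [spi pio]] : exists pi : rhom G S, surj pi /\ forall x, pi (io x) = 0.
  have [p sp] := torsion_quot_ex tN n0; exists (compr p q); split=> [y|x].
    by have [z <-] := sp y; have [w <-] := sq z; exists w; rewrite comprE.
  by rewrite comprE qio hom0.
have [P0 [e [pP0 se te]]] := proj_cover_ex S.
have [U [i ki]] := ker_ex e; have [P1 [c [pP1 sc tc]]] := proj_cover_ex U.
have noloop := simple_no_loop gl sS pP0 pP1 se te ki sc tc.
have noloopU (f : rhom U S) x : f x = 0.
  by have [y <-] := sc x; rewrite -comprE noloop.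
have [a aE] := proj_lift (h := pi) (g := e) pG (fun x => se (pi x)).
have sa : surj a.
  by apply: te => y; have [z zE] := spi (e y); exists z; rewrite aE.
have [b bE] := proj_split pP0 sa.
(* Otherwise the image of [U] in the torsion module [N] would have a quotient [S], giving a nonzero
   map [U -> S]. Hence [b] carries [U] into [L]. *)
have qbi u : q (b (i u)) = 0.
  apply/eqP; apply: contraT => qbu.
  have [X [f [k [sf ik kf]]]] := img_ex (compr q (compr b i)).
  have fu : f u != 0.
    apply: contra qbu => /eqP fu; have := kf u; rewrite fu hom0 !comprE => <- //.
  have [p sp] := torsion_quot_ex (torsion_sub ik tN) fu.
  have [z /eqP[]] := simple_neq0 sS; have [y <-] := sp z; have [w <-] := sf y.
  by rewrite -comprE noloopU.
have [|be beE] := lift_ex (f := compr b i) iio.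
  by move=> x; rewrite comprE; apply/qE/qbi.
have [|al alE] := kernel_lift (f := compr a io) ki.
  by move=> x; rewrite comprE aE pio.
have albe u : al (be u) = u.
  by apply: (inj_inj ki.1); rewrite alE comprE beE comprE bE.
(* [al] is split by [be], so indecomposability of [L] leaves [al] injective or [U = 0]; the latter
   would make [S] projective. *)
have ial : inj al.
  have [||be0|al0] := indL _ _ (img_sub be) (ker_sub al).
  - apply/eqP; rewrite eqEsubv subvf; apply/subvP=> x _.
    rewrite -[x](subrK (be (al x))) addrC memv_add ?memv_img ?memvf //.
    by rewrite memv_ker linearB /= albe subrr.
  - apply/eqP; rewrite -subv0; apply/subvP=> x; rewrite memv_cap memv_ker memv0.
    by case/andP=> /memv_imgP[u _ ->]; rewrite albe => /eqP ->; rewrite hom0.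
  - have U0 (u : U) : u = 0.
      rewrite -[u]albe; have : be u \in limg be by rewrite memv_img ?memvf.
      by rewrite be0 memv0 => /eqP->; rewrite hom0.
    have ie : inj e by move=> x /ki.2[u <-]; rewrite (U0 u) hom0.
    have pS := bij_proj ie se pP0.
    by have := pdS.2 0 (proj2 (pd_le0P S) pS).
  - exact/injP.
have beal x : be (al x) = x by apply: (inj_inj ial); rewrite albe.
have [U2 [j kj]] := ker_ex c.
have kj' : kernel_of j (compr be c).
  split=> [|x]; first exact: kj.1.
  rewrite comprE; split=> [bx|[u <-]]; last by rewrite (kernel_of0 kj) hom0.
  by apply/kj.2; rewrite -[LHS]albe bx hom0.
have sbc : surj (compr be c).
  by move=> x; have [y yE] := sc (al x); exists y; rewrite comprE yE beal.
apply/(@ext1P _ _ _ _ _ L _ _ gl kj' sbc pP1) => h.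
(* Identify [L] with [U] inside [P0]. The extension [g : P1 -> P0] lands in [U], since [e g] is a
   map [P1 -> S] and hence zero. *)
have [|g gE] := radical_map_extends (h := compr i (compr al h)) sS pP0 pP1 te ki sc tc kj.
  by move=> u; rewrite comprE (kernel_of0 ki).
have [|g' gE'] := kernel_lift (f := g) ki.
  by move=> x; rewrite -comprE noloop.
exists (compr be g') => u; rewrite comprE -[RHS]beal; congr (be _).
by apply: (inj_inj ki.1); rewrite gE' gE !comprE.
Qed.

Lemma tau_rigid_pd2_grade2 N :
  indecomposable N -> tau_rigid N -> pd_eq 2 N -> grade_eq 2 N.
Proof.
move=> [_ indN] tauN [_ npdN].
have npd1 : ~ pd_le 1 N by move/npdN.
have [P0 [e [pP0 se te]]] := proj_cover_ex N.
have [O [i ki]] := ker_ex e; have [P1 [c [pP1 sc tc]]] := proj_cover_ex O.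
have fac := proj1 (tau_rigid_cover pP1 pP0 ki se sc te tc) tauN.
have [T [t [kt tT tP]]] := torsion_part_ex N.
have [x x0] : exists x : T, x != 0.
  apply: NNPP => T0; apply/npd1/torsionless_pd1 => y /tP[x <-].
  suff -> : x = 0 by rewrite hom0.
  by apply: NNPP => /eqP x0; apply: T0; exists x.
have [F [p [sp pE]]] := coker_ex t.
have tF : torsionless F.
  move=> y fy; have [z zE] := sp y; rewrite -zE; apply/pE/tP => f.
  have [|g <-] := desc_ex (f := f) sp; last by rewrite zE fy.
  by move=> w /pE[v <-]; rewrite -comprE tT.
have [G [io [pG iio dio]]] := torsionless_closure tF.
have [C [q [sq qE]]] := coker_ex io.
have qio y : q (io y) = 0 by apply/qE; exists y.
have tC : torsion C := dense_coker_torsion dio sq qio.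
have C0 (y : C) : y = 0.
  apply: NNPP => /eqP y0.
  have [th [v0 thv0]] : exists (th : rhom T C) v, th v <> 0.
    have [f sf] := torsion_quot_ex tT x0; have [g ig] := torsion_sub_ex tC y0.
    have [s /eqP s0] := simple_neq0 sS; have [v vE] := sf s.
    by exists (compr g f), v; rewrite comprE vE => /ig.
  (* [V] is the preimage of [T] in [P0], and [b] is its projection onto [T]. *)
  have [V [k kk]] := ker_ex (compr io (compr p e)).
  have pV : projective V by exact: ker_proj gl pP0 pG kk.
  have pt z : p (t z) = 0 by apply/pE; exists z.
  have pek v : p (e (k v)) = 0.
    by apply: iio; have := kernel_of0 kk v; rewrite !comprE.
  have [|b bE] := lift_ex (f := compr e k) kt.1.
    by move=> v; rewrite comprE; apply/pE.
  have sb : surj b.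
    move=> z; have [w wE] := se (t z).
    have /kk.2[v vE] : compr io (compr p e) w = 0 by rewrite !comprE wE pt hom0.
    by exists v; apply: (inj_inj kt.1); rewrite bE comprE vE.
  (* [la] lifts [th b] to [G]. On the syzygy [O] it takes values in [F]; its restriction there,
     lifted to [P1 -> N], factors through [g0 : P0 -> N] by tau-rigidity. *)
  have [la laE] := proj_lift (h := compr th b) (g := q) pV (fun z => sq _).
  have [|om omE] := kernel_lift (f := i) kk.
    by move=> z; rewrite !comprE (kernel_of0 ki) !hom0.
  have bom z : b (om z) = 0.
    by apply: kt.1; rewrite bE comprE omE (kernel_of0 ki).
  have [|xi xiE] := lift_ex (f := compr la om) iio.
    by move=> z; apply/qE; rewrite comprE laE comprE bom hom0.
  have [h hE] := proj_lift (h := compr xi c) (g := p) pP1 (fun z => sp _).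
  have [g0 gE] := fac h.
  have laom z : la (om z) = io (p (g0 (k (om z)))).
    have [w <-] := sc z; rewrite -comprE -xiE; congr (io _).
    by rewrite omE -comprE -hE gE comprE.
  (* The difference kills [O], so it descends to a map from the torsion module [T] to [G]. Thus [la]
     takes values in [F] and [th b = q la = 0]. *)
  have zero v : subr_hom la (compr io (compr p (compr g0 k))) v = 0.
    have [|m <-] := desc_ex (f := subr_hom la (compr io (compr p (compr g0 k)))) sb.
      move=> w bw; have /ki.2[o oE] : e (k w) = 0 by rewrite -(comprE e k) -bE bw hom0.
      have -> : w = om o by apply: (inj_inj kk.1); rewrite omE.
      by rewrite !rhomE laom subrr.
    exact: torsion_proj.
  apply: thv0; have [w <-] := sb v0; rewrite -comprE -laE; have := zero w.
  by rewrite !rhomE => /eqP; rewrite subr_eq0 => /eqP ->.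
have sio : surj io by move=> y; apply/qE.
have [r [rE _]] := bij_inv iio sio.
have pF : projective F := retract_proj (s := io) (r := r) pG rE.
have [s sE] := proj_split pF sp.
have tN : torsion N.
  have pt z : p (t z) = 0 by apply/pE; exists z.
  have [||t0|s0] := indN _ _ (img_sub t) (img_sub s).
  - apply/eqP; rewrite eqEsubv subvf; apply/subvP=> y _.
    rewrite -[y](subrK (s (p y))) memv_add ?memv_img ?memvf //.
    have /pE[z <-] : p (y - s (p y)) = 0 by rewrite homB sE subrr.
    by rewrite memv_img ?memvf.
  - apply/eqP; rewrite -subv0; apply/subvP=> y; rewrite memv_cap memv0.
    case/andP=> /memv_imgP[z _ ->] /memv_imgP[w _ zw].
    have w0 : w = 0 by rewrite -(sE w) -zw pt.
    by rewrite zw w0 hom0.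
  - case/eqP: x0; apply: kt.1; apply/eqP; rewrite -memv0 -t0.
    by rewrite memv_img ?memvf.
  - have F0 (y : F) : y = 0.
      rewrite -[y]sE; have : s y \in limg s by rewrite memv_img ?memvf.
      by rewrite s0 memv0 => /eqP->; rewrite hom0.
    move=> f y; have /pE[z <-] : p y = 0 by exact: F0.
    by rewrite -comprE tT.
split.
  case=> [|[|//]] _.
    have [R _] := gl N; exists R => f fd z.
    have /surjP sR := pr_surj R; have /exactP[_ ex] := pr_exact0 R.
    have [|g <-] := desc_ex (f := f) sR; last exact: tN.
    by move=> w /ex[v <-].
  apply/(@ext1P _ _ _ _ _ (reg A) _ _ gl ki se pP0) => h.
  (* As [N] is torsion, its syzygy [O] is dense in [P0]. *)
  apply: dense_ext ki.1 _ (@reg_proj _ A) => f fi z.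
  have [|g <-] := desc_ex (f := f) se; last exact: tN.
  by move=> w /ki.2[u <-].
(* If [Ext^2(N, A)] vanished, the projective second syzygy [O2] would be a summand of [P1], so [O]
   would be projective and [N] of projective dimension at most 1. *)
have [O2 [j kj]] := ker_ex c.
move/(@ext2P _ _ _ _ _ (reg A) _ _ gl ki se pP0).
move/(@ext1P _ _ _ _ _ (reg A) _ _ gl kj sc pP1) => ext.
have kj' : kernel_of j (compr i c).
  split=> [|z]; first exact: kj.1.
  rewrite comprE; split=> [/ki.1/kj.2 //|[u <-]].
  by rewrite (kernel_of0 kj) hom0.
have [n [y [f b]]] := projP (ker_proj gl pP1 pP0 kj').
have /fin_all_exists[g gE] m := ext (f m).
have [rho rhoE] := comb_ex g y.
have rj u : rho (j u) = u.
  by rewrite rhoE [RHS]b; apply: eq_bigr => m _; rewrite gE.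
apply/npd1/(pd_le1P ki se pP0).
have [|s' sE'] := desc_ex (f := subr_hom (idr P1) (compr j rho)) sc.
  by move=> z /kj.2[u <-]; rewrite !rhomE rj subrr.
apply: (retract_proj (s := s') (r := c) pP1) => z.
have [w <-] := sc z; rewrite sE' !rhomE homB (kernel_of0 kj) subr0 //.
Qed.
End UniqueSimple.
End Dominant.

Theorem theorem1p2 (K : closedFieldType) (A : falgType K)
  (A_basic : basic_alg A) (A_connected : connected_alg A)
  (A_auslander : auslander_alg A) (M : rmod A) :
  (* (1) *)
  (forall S : rmod A, simple_mod S -> tau_rigid S)
  /\
  (* (2), with [N = M^**/M] *)
  (pd_eq 1 M ->
     (forall (N : rmod A) (q : rhom (bidual M) N), is_cokernel (ev M) q ->
        (rigid M <-> Ext_zero 2 N M))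
     /\ (rigid M <-> tau_rigid M))
  /\
  (* (3), with [T = Tr M] *)
  (grade_eq 2 M ->
     forall T : rmod (opalg A), is_transpose M T ->
       (tau_rigid M <-> tau_rigid T /\ pd_eq 1 T))
  /\
  (* (4) *)
  ((exists S : rmod A,
      [/\ simple_mod S, pd_eq 2 S
        & forall S' : rmod A, simple_mod S' -> pd_eq 2 S' -> iso S' S]) ->
     (forall L : rmod A, indecomposable L -> pd_eq 1 L ->
        rigid L /\ tau_rigid L)
     /\
     (forall N : rmod A, indecomposable N -> tau_rigid N -> pd_eq 2 N ->
        grade_eq 2 N)).
Proof.
have [gl [I [_ pI0 pI1]]] := A_auslander.
have keta : kernel_of (ir_eta I) (ir_d I 0).
  by apply/kernel_exact; split; [apply/injP/ir_inj|exact: ir_exact0].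
have [jI0 jI1] := (@ir_injm _ _ _ I 0, @ir_injm _ _ _ I 1).
split; first exact: simple_tau_rigid.
split.
  move=> [pdM _]; split; last exact: rigid_tau_rigid.
  by move=> N q; apply: (rigid_bidual gl jI0 pI0 pI1 keta).
split; first by move=> gM T; apply: tau_rigid_transpose.
case=> S [sS pdS uniS]; split=> [L iL pdL|N].
  have rL : rigid L by apply: (pd1_rigid gl jI0 jI1 pI0 pI1 keta sS pdS uniS).
  by split=> //; apply/(rigid_tau_rigid gl); [case: pdL|].
exact: (tau_rigid_pd2_grade2 gl jI0 pI0 pI1 keta sS uniS).
Qed.
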